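(* Let $\Bbbk$ be a field and let $(V,\Delta,\epsilon,\zeta)$ be a combinatorial coalgebra over $\Bbbk$. Then the map $\psi:V\to\mathsf{QSym}$, $\psi(v)=\sum_\alpha\zeta_\alpha(v)M_\alpha$ (sum over all compositions $\alpha$), is the unique morphism of combinatorial coalgebras $(V,\zeta)\to(\mathsf{QSym},\zeta_{\mathsf{QSym}})$. If $(V,\zeta)$ is a combinatorial bialgebra, then $\psi$ is a morphism of graded bialgebras.
   Context: Graded vector spaces are $V=\bigoplus_{n\in\mathbb N}V_n$, with no finiteness or connectedness assumed; graded linear maps preserve degree. A graded coalgebra $(V,\Delta,\epsilon)$ satisfies $\Delta(V_n)\subset\bigoplus_{i+j=n}V_i\otimes V_j$ and $\epsilon(V_n)=0$ for $n>0$; a graded bialgebra is moreover a bialgebra with $V_iV_j\subset V_{i+j}$ and unit element in $V_0$. $\Bbbk[t]$ is graded with $t$ in degree $1$. For a map $\zeta:V\to\Bbbk[t]$, $\zeta|_{t=0}:V\to\Bbbk$ is $v\mapsto\zeta(v)(0)$. A combinatorial coalgebra is $(V,\Delta,\epsilon,\zeta)$ with $(V,\Delta,\epsilon)$ a graded coalgebra and $\zeta:V\to\Bbbk[t]$ a graded linear map with $\zeta|_{t=0}=\epsilon$. A combinatorial bialgebra is a graded bialgebra with a graded algebra morphism $\zeta:V\to\Bbbk[t]$ with $\zeta|_{t=0}=\epsilon$. A morphism $\phi:(V,\zeta)\to(V',\zeta')$ of combinatorial coalgebras (bialgebras) is a graded coalgebra (bialgebra) morphism $\phi:V\to V'$ with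 $\zeta=\zeta'\circ\phi$. A composition $\alpha\vDash n$ is a sequence $\alpha=(\alpha_1,\dots,\alpha_l)$ of positive integers with sum $n$; $\emptyset$ is the unique composition of $0$. $M_\alpha=\sum_{i_1<\cdots<i_l}x_{i_1}^{\alpha_1}\cdots x_{i_l}^{\alpha_l}\in\Bbbk[[x_1,x_2,\dots]]$, $M_\emptyset=1$. $\mathsf{QSym}=\bigoplus_n\mathsf{QSym}_n$, where $\mathsf{QSym}_n$ has basis $\{M_\alpha:\alpha\vDash n\}$; it is a graded Hopf algebra with the product of power series, coproduct $\Delta(M_\alpha)=\sum_{\alpha=\beta\gamma}M_\beta\otimes M_\gamma$ (over concatenations) and counit $\epsilon(M_\emptyset)=1$, $\epsilon(M_\alpha)=0$ for $\alpha\neq\emptyset$. $\zeta_{\mathsf{QSym}}:\mathsf{QSym}\to\Bbbk[t]$ is the graded algebra morphism with $M_\emptyset\mapsto1$, $M_{(n)}\mapsto t^n$ for $n\ge1$, and $M_\alpha\mapsto0$ for all other $\alpha$. For a combinatorial coalgebra $(V,\Delta,\epsilon,\zeta)$ let $\Delta^{(0)}=\mathrm{id}$, $\Delta^{(1)}=\Delta$ and $\Delta^{(m-1)}=(\Delta^{(m-2)}\otimes\mathrm{id})\circ\Delta:V\to V^{\otimes m}$ for $m>2$. Let $\zeta_\emptyset=\zeta|_{t=0}=\epsilon$, and for a composition $\alpha=(\alpha_1,\dots,\alpha_m)\vDash n>0$ let $\zeta_\alpha(v)$ be the coefficient of $t^{\alpha_1}\otimes\cdots\otimes t^{\alpha_m}$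 in $\zeta^{\otimes m}(\Delta^{(m-1)}(v))\in\Bbbk[t]^{\otimes m}$. For $v\in V_n$ only the compositions $\alpha\vDash n$ contribute to $\psi(v)$, so $\psi(v)\in\mathsf{QSym}$. *)

(* Defs.v *)
From HB Require Import structures.
From mathcomp Require Import all_boot all_order all_algebra generic_quotient.
From mathcomp Require Import finmap boolp classical_sets functions cardinality.
From mathcomp Require Import fsbigop.
From mathcomp.multinomials Require Import monalg.

Set Implicit Arguments.
Unset Strict Implicit.
Unset Printing Implicit Defensive.

Import GRing.Theory.
Local Open Scope ring_scope.
Local Open Scope quotient_scope.

Definition bilinear_map (k : fieldType) (V W X : lmodType k)
    (b : V -> W -> X) : Prop :=
  (forall w, linear (b^~ w)) /\ (forall v, linear (b v)).

Section TensorDef.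
Variables (k : fieldType) (V W : lmodType k).
Implicit Types (s t : seq (V * W)).

Definition formal_eval (X : lmodType k) (b : V -> W -> X) s : X :=
  \sum_(p <- s) b p.1 p.2.

(* A list of pairs stands for the sum of its pure tensors v (x) w.  Two lists
   are identified when no bilinear map out of V x W separates them, which is
   the congruence defining the tensor product; the universal property is
   [tlift_tens], [tlift_linear] and [tlift_unique]. *)
Definition tensor_rel : rel (seq (V * W)) := fun s t =>
  `[< forall (X : lmodType k) (b : V -> W -> X),
        bilinear_map b -> formal_eval b s = formal_eval b t >].

Lemma tensor_rel_equiv : equiv_class_of tensor_rel.
Proof.
split=> [s|s t|t s u].
- exact/asboolP.
- by apply/asboolP/asboolP => H X b Hb; rewrite (H X b Hb).
- by move=> /asboolP H1 /asboolP H2; apply/asboolP => X b Hb; rewrite H1 ?H2.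
Qed.

Canonical tensor_equiv := EquivRelPack tensor_rel_equiv.

Definition tensor := {eq_quot tensor_equiv}.

HB.instance Definition _ := Choice.copy tensor {eq_quot tensor_equiv}.

Definition tpi s : tensor := \pi_tensor s.

Lemma tpiP s t : tpi s = tpi t <->
  forall (X : lmodType k) (b : V -> W -> X),
    bilinear_map b -> formal_eval b s = formal_eval b t.
Proof.
split.
  by move=> /eqP; rewrite /tpi piE => /asboolP.
by move=> H; apply/eqP; rewrite /tpi piE; apply/asboolP.
Qed.

End TensorDef.

Section TensorTheory.
Variables (k : fieldType) (V W : lmodType k).
Implicit Types (s t : seq (V * W)) (x y z : tensor V W).

Definition tens (v : V) (w : W) : tensor V W := tpi [:: (v, w)].

(* The linear map induced by [b]; meaningful when [b] is bilinear. *)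
Definition tlift (X : lmodType k) (b : V -> W -> X) x : X :=
  formal_eval b (repr x).

Lemma tpiK x : tpi (repr x) = x.
Proof. exact: reprK. Qed.

Lemma tlift_tpi (X : lmodType k) (b : V -> W -> X) s :
  bilinear_map b -> tlift b (tpi s) = formal_eval b s.
Proof. by move=> Hb; have /tpiP := tpiK (tpi s); apply. Qed.

Lemma formal_eval_cat (X : lmodType k) (b : V -> W -> X) s t :
  formal_eval b (s ++ t) = formal_eval b s + formal_eval b t.
Proof. exact: big_cat. Qed.

Definition scale_list (a : k) s := [seq (a *: p.1, p.2) | p <- s].

Lemma formal_eval_scale (X : lmodType k) (b : V -> W -> X) a s :
  bilinear_map b -> formal_eval b (scale_list a s) = a *: formal_eval b s.
Proof.
move=> [Hl _]; rewrite /formal_eval big_map scaler_sumr; apply: eq_bigr => p _.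
have /= := Hl p.2 a p.1 0; rewrite !addr0 => ->.
have /= := Hl p.2 (-1) 0 0; rewrite scaler0 addr0 scaleN1r addNr => ->.
by rewrite addr0.
Qed.

Definition tadd x y : tensor V W := tpi (repr x ++ repr y).
Definition topp x : tensor V W := tpi (scale_list (-1) (repr x)).
Definition tscale a x : tensor V W := tpi (scale_list a (repr x)).

Lemma tensorP x y :
  (forall (X : lmodType k) (b : V -> W -> X), bilinear_map b ->
     tlift b x = tlift b y) -> x = y.
Proof. by move=> H; rewrite -[x]tpiK -[y]tpiK; apply/tpiP. Qed.

Lemma tlift_add (X : lmodType k) (b : V -> W -> X) x y :
  bilinear_map b -> tlift b (tadd x y) = tlift b x + tlift b y.
Proof. by move=> Hb; rewrite /tadd tlift_tpi // formal_eval_cat. Qed.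

Lemma tlift_scale (X : lmodType k) (b : V -> W -> X) a x :
  bilinear_map b -> tlift b (tscale a x) = a *: tlift b x.
Proof. by move=> Hb; rewrite /tscale tlift_tpi // formal_eval_scale. Qed.

Lemma tlift_nil (X : lmodType k) (b : V -> W -> X) :
  bilinear_map b -> tlift b (tpi [::]) = 0.
Proof. by move=> Hb; rewrite tlift_tpi // /formal_eval big_nil. Qed.

Fact taddA : associative tadd.
Proof. by move=> x y z; apply: tensorP => X b Hb; rewrite !tlift_add // addrA. Qed.
Fact taddC : commutative tadd.
Proof. by move=> x y; apply: tensorP => X b Hb; rewrite !tlift_add // addrC. Qed.
Fact tadd0 : left_id (tpi [::]) tadd.
Proof. by move=> x; apply: tensorP => X b Hb; rewrite !tlift_add // tlift_nil // add0r. Qed.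
Fact taddN : left_inverse (tpi [::]) topp tadd.
Proof.
move=> x; apply: tensorP => X b Hb.
by rewrite !tlift_add // tlift_nil // tlift_scale // scaleN1r addNr.
Qed.

HB.instance Definition _ :=
  GRing.isZmodule.Build (tensor V W) taddA taddC tadd0 taddN.

Fact tscaleA a b x : tscale a (tscale b x) = tscale (a * b) x.
Proof. by apply: tensorP => X c Hc; rewrite !tlift_scale // scalerA. Qed.
Fact tscale1 : left_id 1 tscale.
Proof. by move=> x; apply: tensorP => X c Hc; rewrite !tlift_scale // scale1r. Qed.
Fact tscaleDr : right_distributive tscale +%R.
Proof.
by move=> a x y; apply: tensorP => X c Hc; rewrite !(tlift_add, tlift_scale) // scalerDr.
Qed.
Fact tscaleDl x : {morph tscale^~ x : a b / a + b}.
Proof.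
by move=> a b; apply: tensorP => X c Hc; rewrite !(tlift_add, tlift_scale) // scalerDl.
Qed.

HB.instance Definition _ := GRing.Zmodule_isLmodule.Build k (tensor V W)
  tscaleA tscale1 tscaleDr tscaleDl.

Lemma tlift_tens (X : lmodType k) (b : V -> W -> X) v w :
  bilinear_map b -> tlift b (tens v w) = b v w.
Proof. by move=> Hb; rewrite tlift_tpi // /formal_eval big_seq1. Qed.

Lemma tlift_linear (X : lmodType k) (b : V -> W -> X) :
  bilinear_map b -> linear (tlift b).
Proof. by move=> Hb a x y; rewrite tlift_add // tlift_scale. Qed.

Lemma tens_bilinear : bilinear_map tens.
Proof.
split=> [w a v v'|v a w w']; apply: tensorP => X b Hb;
  rewrite tlift_linear // !tlift_tens //.
- exact: Hb.1.
- exact: Hb.2.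
Qed.

Lemma tensor_sum x : exists s, x = \sum_(p <- s) tens p.1 p.2.
Proof.
exists (repr x); apply: tensorP => X b Hb; rewrite -{1}[x]tpiK tlift_tpi //.
elim: (repr x) => [|p s IH].
  by rewrite big_nil tlift_nil // /formal_eval big_nil.
by rewrite big_cons tlift_add // -IH /formal_eval big_cons tlift_tens.
Qed.

Lemma tensor_ext (X : lmodType k) (f g : tensor V W -> X) :
  linear f -> linear g -> (forall v w, f (tens v w) = g (tens v w)) -> f =1 g.
Proof.
move=> Hf Hg Hfg x; have [s ->] := tensor_sum x.
have H0 h : linear h -> h 0 = 0 :> X.
  by move=> Hh; have := Hh (-1) 0 0; rewrite scaler0 addr0 scaleN1r addNr.
elim: s => [|p s IH]; first by rewrite big_nil !H0.
by rewrite big_cons -[tens _ _]scale1r Hf Hg Hfg IH.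
Qed.

Lemma tlift_unique (X : lmodType k) (b : V -> W -> X) (f : tensor V W -> X) :
  bilinear_map b -> linear f -> (forall v w, f (tens v w) = b v w) ->
  f =1 tlift b.
Proof.
move=> Hb Hf Hfb; apply: tensor_ext => // [|v w]; first exact: tlift_linear.
by rewrite Hfb tlift_tens.
Qed.

End TensorTheory.

Section Coalgebra.
Variable k : fieldType.

Definition tmap (V W V' W' : lmodType k) (f : V -> V') (g : W -> W') :
    tensor V W -> tensor V' W' :=
  tlift (fun v w => tens (f v) (g w)).

Definition tassoc (U V W : lmodType k) :
    tensor (tensor U V) W -> tensor U (tensor V W) :=
  tlift (fun x w => tlift (fun u v => tens u (tens v w)) x).

Definition tmul (A B : algType k) (x y : tensor A B) : tensor A B :=
  tlift (fun a b => tlift (fun c d => tens (a * c) (b * d)) y) x.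

Record grading (V : lmodType k) := Grading {
  homog :> nat -> set V;
  homog0 : forall n, homog n 0;
  homog_lin : forall n a u v, homog n u -> homog n v -> homog n (a *: u + v);
  homog_sum : forall v, exists N (f : nat -> V),
    (forall i, homog i (f i)) /\ v = \sum_(i < N) f i;
  homog_direct : forall N (f : nat -> V), (forall i, homog i (f i)) ->
    \sum_(i < N) f i = 0 -> forall i, (i < N)%N -> f i = 0
}.

(* The subspace \bigoplus_(i + j = n) V_i (x) V_j of V (x) V. *)
Definition tensor_homog (V : lmodType k) (G : nat -> set V) (n : nat) :
    set (tensor V V) :=
  [set x | exists s : seq (V * V),
     (forall p, p \in s ->
        exists i j, [/\ (i + j = n)%N, G i p.1 & G j p.2]) /\
     x = \sum_(p <- s) tens p.1 p.2].

Definition poly_homog (n : nat) : set {poly k} :=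
  [set p | exists c, p = c *: 'X^n].

Record gradedCoalgebra (V : lmodType k) := GradedCoalgebra {
  gr : grading V;
  cop : {linear V -> tensor V V};
  eps : {scalar V};
  copA : forall v, tassoc (tmap cop id (cop v)) = tmap id cop (cop v);
  (* (eps (x) id) o Delta = id = (id (x) eps) o Delta, k (x) V being V *)
  eps_copl : forall v, tlift (fun x y => eps x *: y) (cop v) = v;
  eps_copr : forall v, tlift (fun x y => eps y *: x) (cop v) = v;
  cop_graded : forall n v, gr n v -> tensor_homog gr n (cop v);
  eps_graded : forall n v, (0 < n)%N -> gr n v -> eps v = 0
}.

Record combCoalgebra (V : lmodType k) := CombCoalgebra {
  gcoalg :> gradedCoalgebra V;
  zeta : {linear V -> {poly k}};
  zeta_graded : forall n v, gr gcoalg n v -> poly_homog n (zeta v);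
  zeta_at0 : forall v, (zeta v).[0] = eps gcoalg v
}.

(* An algebra has 1 != 0; this excludes no bialgebra since [eps 1 = 1]. *)
Record is_gradedBialgebra (A : algType k) (C : gradedCoalgebra A) : Prop := {
  gr_one : gr C 0 1;
  gr_mul : forall i j a b, gr C i a -> gr C j b -> gr C (i + j) (a * b);
  cop_one : cop C 1 = tens 1 1;
  cop_mul : forall a b, cop C (a * b) = tmul (cop C a) (cop C b);
  eps_one : eps C 1 = 1;
  eps_mul : forall a b, eps C (a * b) = eps C a * eps C b
}.

Record is_combBialgebra (A : algType k) (C : combCoalgebra A) : Prop := {
  comb_gradedBialgebra : is_gradedBialgebra C;
  zeta_one : zeta C 1 = 1;
  zeta_mul : forall a b, zeta C (a * b) = zeta C a * zeta C b
}.

Record coalgebra_morphism (V V' : lmodType k) (C : gradedCoalgebra V)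
    (C' : gradedCoalgebra V') (phi : V -> V') : Prop := {
  mor_linear : linear phi;
  mor_graded : forall n v, gr C n v -> gr C' n (phi v);
  mor_cop : forall v, cop C' (phi v) = tmap phi phi (cop C v);
  mor_eps : forall v, eps C' (phi v) = eps C v
}.

Record combCoalgebra_morphism (V V' : lmodType k) (C : combCoalgebra V)
    (C' : combCoalgebra V') (phi : V -> V') : Prop := {
  mor_coalgebra : coalgebra_morphism C C' phi;
  mor_zeta : forall v, zeta C v = zeta C' (phi v)
}.

Record bialgebra_morphism (A A' : algType k) (C : gradedCoalgebra A)
    (C' : gradedCoalgebra A') (phi : A -> A') : Prop := {
  bimor_coalgebra : coalgebra_morphism C C' phi;
  bimor_one : phi 1 = 1;
  bimor_mul : forall a b, phi (a * b) = phi a * phi b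
}.

(* [tpow V n] is V^{(x) n+1}. *)
Fixpoint tpow (V : lmodType k) (n : nat) : lmodType k :=
  if n is n'.+1 then tensor (tpow V n') V else V.

Fixpoint tpow_map (V W : lmodType k) (f : V -> W) n : tpow V n -> tpow W n :=
  if n is n'.+1 then tmap (tpow_map f (n := n')) f else f.

(* [iter_cop C n] is Delta^(n); see [iter_cop1] for Delta^(1) = Delta. *)
Fixpoint iter_cop (V : lmodType k) (C : gradedCoalgebra V) n : V -> tpow V n :=
  if n is n'.+1 then fun v => tmap (iter_cop C n') id (cop C v) else id.

(* The coefficient of t^(a 0) (x) ... (x) t^(a n) in k[t]^{(x) n+1}; see
   [tpow_coef_linear] and [tpow_coef_pure]. *)
Fixpoint tpow_coef (a : nat -> nat) n : tpow {poly k} n -> k^o :=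
  if n is n'.+1
  then tlift (fun x (p : {poly k}) => tpow_coef a (n := n') x * p`_(a n))
  else fun p : {poly k} => p`_(a 0%N).

Lemma tmap_id (V W : lmodType k) (x : tensor V W) : tmap id id x = x.
Proof.
by apply/esym; apply: tlift_unique => //; exact: tens_bilinear.
Qed.

Lemma iter_cop1 (V : lmodType k) (C : gradedCoalgebra V) :
  iter_cop C 1 =1 cop C.
Proof. by move=> v; rewrite /= tmap_id. Qed.

End Coalgebra.

Record composition := Composition {
  parts :> seq nat;
  parts_gt0 : 0%N \notin parts
}.

HB.instance Definition _ := [isSub for parts].
HB.instance Definition _ := [Countable of composition by <:].

Definition comp_nil : composition := @Composition [::] isT.

Lemma comp_take_subproof (a : composition) i : 0%N \notin take i a.
Proof. by apply: contra (parts_gt0 a) => /mem_take. Qed.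
Definition comp_take (a : composition) i := Composition (comp_take_subproof a i).

Lemma comp_drop_subproof (a : composition) i : 0%N \notin drop i a.
Proof. by apply: contra (parts_gt0 a) => /mem_drop. Qed.
Definition comp_drop (a : composition) i := Composition (comp_drop_subproof a i).

Notation mono := {cmonom nat}.

(* Formal power series, as their families of coefficients. *)
Definition series (k : fieldType) : Type := mono -> k.

HB.instance Definition _ (k : fieldType) :=
  GRing.Lmodule.copy (series k) (mono -> k^o).

(* x_(s_0)^(e_0) * x_(s_1)^(e_1) * ... *)
Definition monomial (s e : seq nat) : mono :=
  \big[mmul/mone]_(p <- zip s e) expcmn (ucm p.1) p.2.

Section MonomialTheory.

Lemma expcmnE (m : mono) n i : expcmn m n i = (n * m i)%N.
Proof.
case: n => [|n]; first by rewrite /= onecmE.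
elim: n => [|n IH]; first by rewrite mul1n.
by rewrite mulSn -IH -mulcmE.
Qed.

Lemma monomial_cons i s n e :
  monomial (i :: s) (n :: e) = mmul (expcmn (ucm i) n) (monomial s e).
Proof. by rewrite /monomial big_cons. Qed.

Lemma monomial_notin s e i : i \notin s -> monomial s e i = 0%N.
Proof.
elim: s e => [|j s IH] [|n e] /=;
  rewrite ?/monomial ?big_nil ?cm1 // => H.
rewrite -/(monomial _ _) monomial_cons cmM expcmnE ucmE.
move: H; rewrite inE negb_or => /andP[]; rewrite eq_sym => /negbTE -> Hi.
by rewrite muln0 IH.
Qed.

Definition exps (s : seq nat) (m : mono) : seq nat := [seq m i | i <- s].

Lemma exps_monomial s e : uniq s -> size s = size e ->
  exps s (monomial s e) = e.
Proof.
elim: s e => [|j s IH] [|n e] //= /andP[Hj Hs] [Hsz].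
rewrite monomial_cons cmM expcmnE ucmE eqxx muln1 monomial_notin // addn0.
congr cons; rewrite -[RHS]IH //; apply/eq_in_map => i Hi.
rewrite cmM expcmnE ucmE; case: eqP => [E|_]; first by rewrite E Hi in Hj.
by rewrite muln0.
Qed.

Lemma monomial_exps s (m : mono) : uniq s -> {subset finsupp m <= s} ->
  monomial s (exps s m) = m.
Proof.
move=> Hs Hm; apply/eqP/cmP => i; case: (boolP (i \in s)) => Hi; last first.
  rewrite monomial_notin //; apply/esym/eqP; rewrite cmE_eq0.
  by apply: contra Hi => /Hm.
have := exps_monomial Hs (esym (size_map (fun_of_fsfun m) s)).
by move/eq_in_map => H; rewrite [LHS]H.
Qed.

Lemma monomialD s e e' : size e = size e' ->
  monomial s [seq (p.1 + p.2)%N | p <- zip e e'] =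
  mmul (monomial s e) (monomial s e').
Proof.
elim: s e e' => [|i s IH] [|n e] [|n' e'] //=.
- by rewrite /monomial big_nil mulm1.
- by rewrite /monomial big_nil mulm1.
- by rewrite /monomial big_nil mulm1.
move=> [H]; rewrite !monomial_cons IH //; apply/eqP/cmP => j.
by rewrite !cmM !expcmnE mulnDl addnACA.
Qed.

Lemma cmono_sorted (m : mono) : sorted ltn (sort leq (finsupp m)).
Proof.
rewrite ltn_sorted_uniq_leq sort_uniq fset_uniq /=; exact/sort_sorted/leq_total.
Qed.

Definition msorted (m : mono) : seq nat := sort leq (finsupp m).

Lemma mem_msorted m i : (i \in msorted m) = (i \in finsupp m).
Proof. exact: mem_sort. Qed.

Lemma msorted_uniq m : uniq (msorted m).
Proof. by rewrite sort_uniq fset_uniq. Qed.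

(* The nonzero exponents of m, in the order of the variables. *)
Lemma flat_subproof m : 0%N \notin exps (msorted m) m.
Proof.
apply/mapP => -[i]; rewrite mem_msorted => Hi /esym/eqP.
by rewrite cmE_eq0 Hi.
Qed.
Definition flat m : composition := Composition (flat_subproof m).

Lemma finsupp_monomial s (a : composition) : size s = size a -> uniq s ->
  finsupp (monomial s a) =i s.
Proof.
move=> Hsz Hs i; rewrite -cmE_neq0; case: (boolP (i \in s)) => Hi; last first.
  by rewrite monomial_notin.
have H := exps_monomial Hs Hsz.
have : monomial s a i \in exps s (monomial s a) by apply: map_f.
by rewrite H => Hin; apply: contra (parts_gt0 a) => /eqP <-.
Qed.

Lemma msorted_monomial s (a : composition) : size s = size a -> sorted ltn s ->
  msorted (monomial s a) = s.
Proof.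
move=> Hsz Hs; have Hu : uniq s by move: Hs; rewrite ltn_sorted_uniq_leq => /andP[].
apply: (irr_sorted_eq ltn_trans ltnn (cmono_sorted _) Hs) => i.
by rewrite mem_msorted finsupp_monomial.
Qed.

Lemma flat_monomial s (a : composition) : size s = size a -> sorted ltn s ->
  flat (monomial s a) = a.
Proof.
move=> Hsz Hs; have Hu : uniq s by move: Hs; rewrite ltn_sorted_uniq_leq => /andP[].
by apply: val_inj; rewrite /= msorted_monomial // exps_monomial.
Qed.

Lemma monomial_flat m : monomial (msorted m) (flat m) = m.
Proof.
by apply: monomial_exps; [exact: msorted_uniq | move=> i; rewrite mem_msorted].
Qed.

Lemma sumn_flat m : sumn (flat m) = mdeg m.
Proof.
rewrite mdegE sumnE big_map; apply/perm_big; exact: permEl (perm_sort _ _).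
Qed.

Lemma finite_factors (m : mono) :
  finite_set [set p : mono * mono | mmul p.1 p.2 = m].
Proof.
pose d := finsupp m; pose N := \max_(i <- d) m i.
pose g (f : {ffun d -> 'I_N.+1}) : mono :=
  mkcmonom [fsfun i : d => nat_of_ord (f i) | 0%N].
pose h f : mono * mono := (g f, divcm m (g f)).
apply: (@sub_finite_set _ _ (h @` [set: {ffun d -> 'I_N.+1}])); last first.
  exact/finite_image/finite_finset.
move=> [p q] /= Hpq.
have Hi i : (p i + q i)%N = m i by rewrite -Hpq cmM.
have Hp : p = g [ffun i => inord (p (val i))].
  apply/eqP/cmP => i; rewrite /g cmE fsfun_ffun; case: insubP => /= [u Hu <-|].
    rewrite ffunE inordK // ltnS (leq_trans (leq_addr (q (val u)) _)) // Hi.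
    by apply: (@leq_bigmax_seq _ _ _ (fun i => m i)); rewrite ?Hu //; exact: valP.
  by rewrite -cmE_eq0 -Hi addn_eq0 => /andP[/eqP].
exists [ffun i => inord (p (val i))] => //; rewrite /h -Hp; congr pair.
by apply/eqP/cmP => i; rewrite divcmE -Hi addKn.
Qed.

Definition factors (m : mono) : {fset mono * mono} :=
  fset_set [set p : mono * mono | mmul p.1 p.2 = m].

Lemma mem_factors m p : (p \in factors m) = (mmul p.1 p.2 == m).
Proof.
rewrite in_fset_set; last exact: finite_factors.
by apply/idP/eqP; rewrite inE.
Qed.

End MonomialTheory.

Lemma uniq_allpairs_dep (T S R : eqType) (f : T -> S -> R) (s : seq T)
    (t : T -> seq S) :
  uniq s -> (forall x, uniq (t x)) ->
  (forall x y x' y', x \in s -> y \in t x -> x' \in s -> y' \in t x' ->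
     f x y = f x' y' -> (x, y) = (x', y')) ->
  uniq [seq f x y | x <- s, y <- t x].
Proof.
move=> Hs Ht H; apply: allpairs_uniq_dep => //.
move=> _ _ /allpairsPdep[x [y [Hx Hy ->]]] /allpairsPdep[x' [y' [Hx' Hy' ->]]] /= E.
by have [-> ->] := H _ _ _ _ Hx Hy Hx' Hy' E.
Qed.

Section SeriesRing.
Variable k : fieldType.
Implicit Types (f g h : series k).

Definition series_mul f g : series k :=
  fun m => \sum_(p \in [set p : mono * mono | mmul p.1 p.2 = m]) f p.1 * g p.2.

Definition series_one : series k := fun m => (m == mone)%:R.

Lemma series_mulE f g m :
  series_mul f g m = \sum_(p <- factors m) f p.1 * g p.2.
Proof. by rewrite /series_mul fsbig_finite //; exact: finite_factors. Qed.

Lemma seriesP f g : (forall m, f m = g m) -> f = g.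
Proof. exact: funext. Qed.

Lemma series_addE f g m : (f + g) m = f m + g m. Proof. by []. Qed.

Fact series_mulA : associative series_mul.
Proof.
move=> f g h; apply: seriesP => m; rewrite !series_mulE.
under eq_bigr do rewrite series_mulE mulr_sumr.
under [RHS]eq_bigr do rewrite series_mulE mulr_suml.
pose F (t : mono * mono * mono) := f t.1.1 * g t.1.2 * h t.2.
transitivity (\sum_(t <- [seq (p.1, q.1, q.2) | p <- factors m, q <- factors p.2]) F t).
  by rewrite big_allpairs_dep; apply: eq_bigr => p _; apply: eq_bigr => q _; rewrite mulrA.
transitivity (\sum_(t <- [seq (q.1, q.2, p.2) | p <- factors m, q <- factors p.1]) F t);
  last by rewrite big_allpairs_dep.
apply: perm_big; apply: uniq_perm.
- apply: uniq_allpairs_dep => [|p|]; [exact: fset_uniq|exact: fset_uniq|].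
  move=> [a b] [c d] [a' b'] [c' d']; rewrite !mem_factors /=.
  by move=> _ /eqP<- _ /eqP<- [-> -> ->].
- apply: uniq_allpairs_dep => [|p|]; [exact: fset_uniq|exact: fset_uniq|].
  move=> [a b] [c d] [a' b'] [c' d']; rewrite !mem_factors /=.
  by move=> _ /eqP<- _ /eqP<- [-> -> ->].
move=> [[a b] c]; apply/allpairsPdep/allpairsPdep => -[[x y] [[z w] []]];
  rewrite !mem_factors /= => /eqP <- /eqP <- [-> -> ->].
- by exists (mmul x z, w), (x, z); rewrite !mem_factors /= mulmA !eqxx.
- by exists (z, mmul w y), (w, y); rewrite !mem_factors /= mulmA !eqxx.
Qed.

Fact series_mulC : commutative series_mul.
Proof.
move=> f g; apply: seriesP => m; rewrite !series_mulE.
transitivity (\sum_(p <- [seq (p.2, p.1) | p <- factors m]) f p.1 * g p.2).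
  apply: perm_big; apply: uniq_perm; first exact: fset_uniq.
    by rewrite map_inj_uniq ?fset_uniq // => -[a b] [c d] [-> ->].
  move=> [a b]; rewrite mem_factors /=; apply/idP/mapP => [H|[[c d] /[swap] [] [-> ->]]].
    by exists (b, a); rewrite // mem_factors /= mulmC.
  by rewrite mem_factors /= mulmC.
by rewrite big_map; apply: eq_bigr => p _; rewrite mulrC.
Qed.

Fact series_mul1 : left_id series_one series_mul.
Proof.
move=> f; apply: seriesP => m; rewrite series_mulE.
rewrite (bigD1_seq (mone, m)) ?fset_uniq ?mem_factors /= ?mul1m //.
rewrite /series_one eqxx mul1r big_seq_cond big1 ?addr0 // => -[a b] /=.
rewrite mem_factors /= => /andP[/eqP <-]; rewrite xpair_eqE negb_and.
by case: (a =P mone) => [->|]; rewrite ?mul1m ?eqxx // mul0r.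
Qed.

Fact series_mulDl : left_distributive series_mul +%R.
Proof.
move=> f g h; apply: seriesP => m; rewrite series_addE !series_mulE -big_split.
by apply: eq_bigr => p _; rewrite series_addE mulrDl.
Qed.

Fact series_one_neq0 : series_one != 0.
Proof.
apply/eqP => /(congr1 (fun f : series k => f mone)); rewrite /series_one eqxx.
by move/eqP; rewrite oner_eq0.
Qed.

HB.instance Definition _ := GRing.Zmodule_isComNzRing.Build (series k)
  series_mulA series_mulC series_mul1 series_mulDl series_one_neq0.

Fact series_scaleAl (a : k) (f g : series k) : a *: (f * g) = (a *: f) * g.
Proof.
apply: seriesP => m; rewrite [LHS]/GRing.scale /= /GRing.mul /= !series_mulE.
rewrite [LHS]mulr_sumr; apply: eq_bigr => p _; exact: mulrA.
Qed.

HB.instance Definition _ :=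
  GRing.Lmodule_isLalgebra.Build k (series k) series_scaleAl.
HB.instance Definition _ := GRing.Lalgebra_isComAlgebra.Build k (series k).

End SeriesRing.

Section QSymSeries.
Variable k : fieldType.
Implicit Types (a : composition) (f g : series k).

(* M_a, the sum over i_0 < ... < i_(l-1) of the monomials
   x_(i_0)^(a_0) ... x_(i_(l-1))^(a_(l-1)), taken coefficient by coefficient:
   each monomial occurs at most once. *)
Definition msum a : series k := fun m =>
  \sum_(s \in [set s : seq nat | sorted ltn s /\ size s = size a])
    ((m == monomial s a)%:R : k).

Lemma msumE a m : msum a m = (flat m == a)%:R.
Proof.
rewrite /msum; case: eqP => [<-|Hm]; last first.
  rewrite fsbig1 // => s /= [Hs Hsz]; case: eqP => // E.
  by case: Hm; rewrite E flat_monomial.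
rewrite -(@fsbig_widen _ _ 0 +%R [set msorted m]).
- by rewrite fsbig_set1 monomial_flat eqxx.
- by move=> s /= ->; rewrite cmono_sorted size_map.
- move=> s /= [[Hs Hsz] Hne]; case: eqP => // E; case: Hne.
  by rewrite E (msorted_monomial (a := flat m)).
Qed.

Definition qsym_pred : {pred series k} := fun f =>
  `[< exists r : seq (k * composition), f = \sum_(p <- r) p.1 *: msum p.2 >].

Lemma series_sumE (I : Type) (r : seq I) (F : I -> series k) m :
  (\sum_(i <- r) F i) m = \sum_(i <- r) F i m.
Proof.
by elim: r => [|i r IH]; rewrite ?big_nil // !big_cons series_addE IH.
Qed.

Lemma series_scaleE (c : k) f m : (c *: f) m = c * f m.
Proof. by []. Qed.

Fixpoint bounded_seqs (n N : nat) : seq (seq nat) :=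
  if n is n'.+1 then
    [::] :: [seq i :: e | i <- iota 1 N, e <- bounded_seqs n' N]
  else [:: [::]].

Lemma mem_bounded_seqs n N (s : seq nat) :
  (size s <= n)%N -> (forall i, i \in s -> (0 < i <= N)%N) ->
  s \in bounded_seqs n N.
Proof.
elim: n s => [|n IH] [|i s] //= Hsz Hs; rewrite inE; apply/allpairsP.
exists (i, s); split => //=.
  by rewrite mem_iota add1n ltnS; apply: Hs; rewrite inE eqxx.
by apply: IH => // j Hj; apply: Hs; rewrite inE Hj orbT.
Qed.

Definition comps (N : nat) : seq composition :=
  undup (pmap insub (bounded_seqs N N)).

Lemma comps_uniq N : uniq (comps N).
Proof. exact: undup_uniq. Qed.

Lemma mem_comps N a : (sumn a <= N)%N -> a \in comps N.
Proof.
move=> H; rewrite mem_undup mem_pmap_sub; apply: mem_bounded_seqs.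
  apply: leq_trans H; case: a => s /=; elim: s => //= i s IH.
  rewrite inE negb_or => /andP[Hi Hs]; rewrite -add1n leq_add ?IH //.
  by rewrite lt0n eq_sym.
move=> i Hi; rewrite lt0n; apply/andP; split.
  by apply: contra (parts_gt0 a) => /eqP <-.
apply: leq_trans H; case: a Hi => s /= _; elim: s => //= j s IH.
rewrite inE => /orP[/eqP ->|Hi]; first exact: leq_addr.
exact: leq_trans (IH Hi) (leq_addl _ _).
Qed.

Lemma big_comps (X : lmodType k) N (c : composition -> k) (F : composition -> X) a :
  (forall b, b != a -> c b = 0) -> (c a != 0 -> (sumn a <= N)%N) ->
  \sum_(b <- comps N) c b *: F b = c a *: F a.
Proof.
move=> Hb Ha; case: (eqVneq (c a) 0) => [H0|/Ha /mem_comps Hin].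
  rewrite H0 scale0r big1 // => b _; case: (eqVneq b a) => [->|/Hb ->].
    by rewrite H0 scale0r.
  by rewrite scale0r.
rewrite (bigD1_seq a) ?comps_uniq //= big1 ?addr0 // => b /Hb ->.
by rewrite scale0r.
Qed.

Definition rep a : mono := monomial (iota 0 (size a)) a.

Lemma flat_rep a : flat (rep a) = a.
Proof. by rewrite flat_monomial ?size_iota ?iota_ltn_sorted. Qed.

Lemma qsym_predP f : reflect
  ((exists N, forall m, (N < mdeg m)%N -> f m = 0) /\
   (forall m m', flat m = flat m' -> f m = f m'))
  (f \in qsym_pred).
Proof.
apply: (iffP (asboolP _)) => [[r ->]|[[N HN] Hf]].
  split; last first.
    move=> m m' H; rewrite !series_sumE; apply: eq_bigr => p _.
    by rewrite !series_scaleE !msumE H.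
  exists (\sum_(p <- r) sumn p.2)%N => m Hm; rewrite series_sumE big_seq big1 //.
  move=> p Hp; rewrite series_scaleE msumE; case: eqP => [E|]; last by rewrite mulr0.
  move: Hm; rewrite -sumn_flat E ltnNge => /negP[].
  by rewrite (big_rem p) //= leq_addr.
exists [seq (f (rep a), a) | a <- comps N]; rewrite big_map; apply: seriesP => m.
rewrite series_sumE.
under eq_bigr do rewrite series_scaleE msumE /= mulr_natr mulrb.
transitivity (\sum_(b <- comps N) (if flat m == b then f (rep b) else 0) *: (1 : k^o)).
  rewrite (@big_comps _ N (fun b => if flat m == b then f (rep b) else 0) (fun=> 1) (flat m)) ?eqxx => [|b|].
  - rewrite [RHS]mulr1; apply: Hf; exact/esym/flat_rep.
  - by rewrite eq_sym => /negbTE ->.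
  - move=> H; rewrite leqNgt; apply: contra H => H; apply/eqP/HN.
    by rewrite -sumn_flat flat_rep.
by apply: eq_bigr => b _; rewrite [LHS]mulr1.
Qed.

(* The exponents along the increasing list [s] are moved to the list [s']. *)
Definition transport (s s' : seq nat) (m : mono) : mono := monomial s' (exps s m).

Lemma transportK s s' (m : mono) : uniq s -> uniq s' -> size s = size s' ->
  {subset finsupp m <= s} -> transport s' s (transport s s' m) = m.
Proof.
move=> Hs Hs' Hsz Hm; rewrite /transport exps_monomial ?monomial_exps //.
by rewrite size_map.
Qed.

Lemma expsM s (p q : mono) :
  exps s (mmul p q) = [seq (x.1 + x.2)%N | x <- zip (exps s p) (exps s q)].
Proof. by elim: s => //= i s ->; rewrite cmM. Qed.

Lemma transportM s s' p q : transport s s' (mmul p q) = mmul (transport s s' p) (transport s s' q).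
Proof. by rewrite /transport expsM monomialD // !size_map. Qed.

Lemma finsupp_transport s s' (m : mono) : size s = size s' -> {subset finsupp (transport s s' m) <= s'}.
Proof.
move=> Hsz i; rewrite -cmE_neq0; apply: contraR => Hi.
by rewrite monomial_notin.
Qed.

Lemma flat_sub s (m : mono) : sorted ltn s -> {subset finsupp m <= s} ->
  flat m = [seq x <- exps s m | x != 0%N] :> seq nat.
Proof.
move=> Hs Hm; rewrite /= /exps filter_map; congr map.
apply: (irr_sorted_eq ltn_trans ltnn (cmono_sorted _)).
  exact: (sorted_filter ltn_trans).
move=> i; rewrite mem_msorted mem_filter /= cmE_neq0.
by case: (boolP (_ \in finsupp m)) => // /Hm ->.
Qed.

Lemma flat_transport s s' (m : mono) : sorted ltn s -> sorted ltn s' -> size s = size s' ->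
  {subset finsupp m <= s} -> flat (transport s s' m) = flat m.
Proof.
move=> Hs Hs' Hsz Hm; apply: val_inj.
rewrite [LHS](flat_sub Hs' (finsupp_transport Hsz)) [RHS](flat_sub Hs Hm) exps_monomial //.
- by move: Hs'; rewrite ltn_sorted_uniq_leq => /andP[].
- by rewrite size_map.
Qed.

Lemma factor_sub m (p : mono * mono) : p \in factors m ->
  {subset finsupp p.1 <= msorted m} /\ {subset finsupp p.2 <= msorted m}.
Proof.
rewrite mem_factors => /eqP <-; split=> i; rewrite mem_msorted mdomD in_fsetU => ->;
  by rewrite ?orbT.
Qed.

Lemma qsym_mul_closed f g :
  f \in qsym_pred -> g \in qsym_pred -> f * g \in qsym_pred.
Proof.
move=> /qsym_predP[[N HN] Hf] /qsym_predP[[N' HN'] Hg]; apply/qsym_predP; split.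
  exists (N + N')%N => m Hm; rewrite [LHS]series_mulE big_seq big1 // => -[p q].
  rewrite mem_factors /= => /eqP E; move: Hm; rewrite -E mdegM.
  case: (ltnP N (mdeg p)) => [/HN ->|Hp]; first by rewrite mul0r.
  case: (ltnP N' (mdeg q)) => [/HN' ->|Hq]; first by rewrite mulr0.
  by rewrite ltnNge leq_add.
move=> m m' E; rewrite [LHS]series_mulE [RHS]series_mulE.
have Es : size (msorted m) = size (msorted m').
  by have := congr1 (fun a : composition => size a) E; rewrite /= !size_map.
have St := cmono_sorted; have U := msorted_uniq.
have Em : transport (msorted m) (msorted m') m = m'.
  rewrite /transport -[exps _ _]/(parts (flat m)) E; exact: monomial_flat.
have Em' : transport (msorted m') (msorted m) m' = m.
  rewrite /transport -[exps _ _]/(parts (flat m')) -E; exact: monomial_flat.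
pose F s s' (p : mono * mono) := (transport s s' p.1, transport s s' p.2).
transitivity (\sum_(p <- factors m)
    f (F (msorted m) (msorted m') p).1 * g (F (msorted m) (msorted m') p).2).
  rewrite big_seq [RHS]big_seq; apply: eq_bigr => p /factor_sub[H1 H2] /=.
  by congr (_ * _); [apply: Hf|apply: Hg]; rewrite flat_transport //; exact: St.
rewrite -(big_map _ xpredT (fun p => f p.1 * g p.2)); apply: perm_big.
have FK : {in factors m, cancel (F (msorted m) (msorted m')) (F (msorted m') (msorted m))}.
  move=> [p q] /factor_sub[H1 H2]; rewrite /F /=.
  by rewrite !transportK.
have FK' : {in factors m', cancel (F (msorted m') (msorted m)) (F (msorted m) (msorted m'))}.
  move=> [p q] /factor_sub[H1 H2]; rewrite /F /=.
  by rewrite !transportK.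
apply: uniq_perm; rewrite ?fset_uniq //.
  rewrite map_inj_in_uniq ?fset_uniq // => p q Hp Hq H.
  by rewrite -[p]FK // H FK.
move=> p; apply/mapP/idP => [[q Hq ->]|Hp].
  move: Hq; rewrite !mem_factors /= -transportM => /eqP ->; exact/eqP.
exists (F (msorted m') (msorted m) p); last by rewrite FK'.
move: Hp; rewrite !mem_factors /= -transportM => /eqP ->; exact/eqP.
Qed.

Fact qsym_subalg : subalg_closed qsym_pred.
Proof.
split; last exact: qsym_mul_closed.
  apply/qsym_predP; split.
    exists 0%N => m Hm; rewrite [LHS]/GRing.one /= /series_one.
    by case: eqP Hm => // ->; rewrite mdeg1.
  move=> m m' E; rewrite /GRing.one /= /series_one; congr (_%:R).
  by rewrite -!mdeg_eq0 -!sumn_flat E.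
move=> c f g /qsym_predP[[N HN] Hf] /qsym_predP[[N' HN'] Hg]; apply/qsym_predP.
split=> [|m m' E]; last by rewrite !series_addE !series_scaleE (Hf _ _ E) (Hg _ _ E).
exists (maxn N N') => m; rewrite gtn_max => /andP[H1 H2].
by rewrite series_addE series_scaleE HN // HN' // mulr0 addr0.
Qed.

HB.instance Definition _ := GRing.isSubalgClosed.Build k (series k) qsym_pred
  qsym_subalg.

End QSymSeries.

Record qsym (k : fieldType) := QSym {
  qseries :> series k;
  qsymP : qseries \in @qsym_pred k
}.

HB.instance Definition _ (k : fieldType) := [isSub for @qseries k].
HB.instance Definition _ (k : fieldType) := [Choice of qsym k by <:].
HB.instance Definition _ (k : fieldType) :=
  [SubChoice_isSubAlgebra of qsym k by <:].

Section QSym.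
Variable k : fieldType.
Implicit Types (a b c : composition) (f g : qsym k).

Lemma msum_qsym a : msum k a \in @qsym_pred k.
Proof. by apply/asboolP; exists [:: (1, a)]; rewrite big_seq1 scale1r. Qed.

Definition qM a : qsym k := QSym (msum_qsym a).

(* The coefficient of M_a in f is read off at the monomial
   x_0^(a_0) ... x_(l-1)^(a_(l-1)). *)
Definition qcoord a f : k := qseries f (rep a).

Lemma qcoord_M a b : qcoord a (qM b) = (a == b)%:R.
Proof. by rewrite /qcoord /= msumE flat_rep. Qed.

Lemma qcoord_linear a : linear (qcoord a : qsym k -> k^o).
Proof. by []. Qed.

Lemma qcoord_flat f m : qseries f m = qcoord (flat m) f.
Proof.
have /qsym_predP[_ H] := qsymP f; apply: H; exact/esym/flat_rep.
Qed.

Lemma qcoordP f g : (forall a, qcoord a f = qcoord a g) -> f = g.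
Proof. by move=> H; apply/val_inj/seriesP => m; rewrite /= !qcoord_flat. Qed.

Lemma qcoord_bounded f : exists N, forall a, qcoord a f != 0 -> (sumn a <= N)%N.
Proof.
have /qsym_predP[[N HN] _] := qsymP f; exists N => a.
rewrite /qcoord leqNgt => H; apply: contra H => H; apply/eqP/HN.
by rewrite -sumn_flat flat_rep.
Qed.

(* The linear map sending M_a to F a. *)
Definition qlift (X : lmodType k) (F : composition -> X) f : X :=
  \sum_(a \in [set: composition]) qcoord a f *: F a.

Section QLift.
Variables (X : lmodType k) (F : composition -> X).

Lemma qliftE N f : (forall a, qcoord a f != 0 -> (sumn a <= N)%N) ->
  qlift F f = \sum_(a <- comps N) qcoord a f *: F a.
Proof.
move=> H; rewrite /qlift -(@fsbig_widen _ _ 0 +%R [set` comps N]).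
- by rewrite -fsbig_seq // comps_uniq.
- by [].
- move=> a /= [_ Ha]; apply/eqP; rewrite scaler_eq0; apply/orP; left.
  by apply: contraT => /H /mem_comps.
Qed.

Lemma qlift_linear : linear (qlift F).
Proof.
move=> c f g; have [N HN] := qcoord_bounded f; have [N' HN'] := qcoord_bounded g.
rewrite !(@qliftE (N + N')).
- rewrite scaler_sumr -big_split; apply: eq_bigr => a _.
  by rewrite qcoord_linear scalerDl scalerA.
- by move=> a /HN' /leq_trans; apply; exact: leq_addl.
- by move=> a /HN /leq_trans; apply; exact: leq_addr.
move=> a; rewrite qcoord_linear.
case: (eqVneq (qcoord a f) 0) => [->|/HN H _]; last exact: leq_trans H (leq_addr _ _).
rewrite scaler0 add0r => /HN' H; exact: leq_trans H (leq_addl _ _).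
Qed.

Lemma qlift_M a : qlift F (qM a) = F a.
Proof.
rewrite (@qliftE (sumn a)) => [|b]; rewrite ?qcoord_M.
- rewrite (@big_comps k X _ (fun b => qcoord b (qM a)) F a).
  + by rewrite qcoord_M eqxx scale1r.
  + by move=> b; rewrite qcoord_M => /negbTE ->.
  + by [].
- by case: (b =P a) => [->//|_]; rewrite eqxx.
Qed.

End QLift.

Lemma qlift_qM f : qlift qM f = f.
Proof.
apply: qcoordP => a; have [N HN] := qcoord_bounded f; rewrite (qliftE _ HN).
have H r : qcoord a (\sum_(b <- r) qcoord b f *: qM b) =
    \sum_(b <- r) (qcoord b f *+ (b == a)) *: (1 : k^o).
  elim: r => [|b r IH]; first by rewrite !big_nil.
  rewrite !big_cons qcoord_linear IH qcoord_M eq_sym; congr (_ + _).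
  by case: eqP => _; rewrite ?scale0r // [LHS]mulr0.
rewrite H (@big_comps k _ N (fun b => qcoord b f *+ (b == a)) (fun=> (1 : k^o)) a).
- by rewrite eqxx mulr1n [LHS]mulr1.
- by move=> b /negbTE ->.
- by rewrite eqxx mulr1n => /HN.
Qed.

Lemma linear_sum (V W : lmodType k) (L : V -> W) (I : Type) (r : seq I)
    (c : I -> k) (v : I -> V) : linear L ->
  L (\sum_(i <- r) c i *: v i) = \sum_(i <- r) c i *: L (v i).
Proof.
move=> HL; elim: r => [|i r IH]; last by rewrite !big_cons HL IH.
by rewrite !big_nil; have := HL (-1) 0 0; rewrite scaler0 addr0 scaleN1r addNr.
Qed.

Lemma qlift_unique (X : lmodType k) (F : composition -> X) (L : qsym k -> X) :
  linear L -> (forall a, L (qM a) = F a) -> L =1 qlift F.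
Proof.
move=> HL HF f; have [N HN] := qcoord_bounded f.
rewrite -{1}[f]qlift_qM (qliftE _ HN) (qliftE _ HN) linear_sum //.
by apply: eq_bigr => a _; rewrite HF.
Qed.

Lemma qsym_ext (X : lmodType k) (L L' : qsym k -> X) :
  linear L -> linear L' -> (forall a, L (qM a) = L' (qM a)) -> L =1 L'.
Proof.
move=> HL HL' H f; rewrite (qlift_unique HL H).
exact/esym/(qlift_unique HL').
Qed.

Definition qsym_homog (n : nat) : set (qsym k) :=
  [set f | exists r : seq (k * composition),
     (forall p, p \in r -> sumn p.2 = n) /\ f = \sum_(p <- r) p.1 *: qM p.2].

Lemma qsym_homogP n f :
  qsym_homog n f <-> (forall a, qcoord a f != 0 -> sumn a = n).
Proof.
split=> [[r [Hr ->]] a|H].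
  elim: r Hr => [|p r IH] Hr; first by rewrite big_nil eqxx.
  rewrite big_cons qcoord_linear qcoord_M.
  case: (a =P p.2) => [-> _|_]; first by apply: Hr; rewrite inE eqxx.
  by rewrite scaler0 add0r; apply: IH => q Hq; apply: Hr; rewrite inE Hq orbT.
have [N HN] := qcoord_bounded f.
exists [seq (qcoord a f, a) | a <- comps N & qcoord a f != 0]; split.
  by move=> p /mapP[a + ->] /=; rewrite mem_filter => /andP[/H].
rewrite big_map big_filter big_mkcond /= -{1}[f]qlift_qM (qliftE _ HN).
by apply: eq_bigr => a _; case: eqP => [->|//]; rewrite scale0r.
Qed.

Fact qsym_homog0 n : qsym_homog n 0.
Proof. by apply/qsym_homogP => a; rewrite eqxx. Qed.

Fact qsym_homog_lin n (x : k) f g : qsym_homog n f -> qsym_homog n g ->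
  qsym_homog n (x *: f + g).
Proof.
move=> /qsym_homogP Hf /qsym_homogP Hg; apply/qsym_homogP => a.
rewrite qcoord_linear; case: (eqVneq (qcoord a f) 0) => [->|/Hf //].
by rewrite scaler0 add0r => /Hg.
Qed.

Fact qsym_homog_sum f : exists N (F : nat -> qsym k),
  (forall i, qsym_homog i (F i)) /\ f = \sum_(i < N) F i.
Proof.
have [N HN] := qcoord_bounded f; exists N.+1.
exists (fun i => \sum_(a <- comps N | sumn a == i) qcoord a f *: qM a); split.
  move=> i; exists [seq (qcoord a f, a) | a <- comps N & sumn a == i]; split.
    by move=> p /mapP[a + ->]; rewrite mem_filter => /andP[/eqP].
  by rewrite big_map big_filter.
rewrite -{1}[f]qlift_qM (qliftE _ HN) (exchange_big_dep xpredT) //=; apply: eq_bigr => a _.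
case: (eqVneq (qcoord a f) 0) => [->|Ha].
  by rewrite scale0r big1 // => i _; rewrite scale0r.
rewrite (big_pred1 (Ordinal (HN _ Ha : (sumn a < N.+1)%N))) //.
Qed.

Fact qsym_homog_direct N (F : nat -> qsym k) : (forall i, qsym_homog i (F i)) ->
  \sum_(i < N) F i = 0 -> forall i, (i < N)%N -> F i = 0.
Proof.
move=> HF H0 i Hi; apply: qcoordP => a; rewrite [RHS](_ : _ = 0) //.
case: (eqVneq (sumn a) i) => Ha; last first.
  apply/eqP; apply: contraT => H; case/eqP: Ha.
  by have /qsym_homogP := HF i; apply.
have := congr1 (qcoord a) H0; rewrite [RHS](_ : _ = 0) // => <-.
have -> : qcoord a (\sum_(j < N) F j) = \sum_(j < N) qcoord a (F j).
  by elim/big_rec2: _ => // j x y _ <-; rewrite -[F j in LHS]scale1r qcoord_linear scale1r.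
rewrite (bigD1 (Ordinal Hi)) //= big1 ?addr0 // => j Hj.
apply/eqP; apply: contraT => H; have /qsym_homogP/(_ a H) := HF j.
by rewrite Ha => E; case/eqP: Hj; apply: val_inj.
Qed.

Definition qsym_grading : grading (qsym k) :=
  Grading qsym_homog0 qsym_homog_lin qsym_homog_sum qsym_homog_direct.

End QSym.

Section TensorLinear.
Variable k : fieldType.

Lemma linear_at0 (V W : lmodType k) (L : V -> W) : linear L -> L 0 = 0.
Proof. by move=> H; have := H (-1) 0 0; rewrite scaler0 addr0 scaleN1r addNr. Qed.

Lemma tmap_bilinear (V W V' W' : lmodType k) (f : V -> V') (g : W -> W') :
  linear f -> linear g -> bilinear_map (fun v w => tens (f v) (g w)).
Proof.
move=> Hf Hg; have [H1 H2] := @tens_bilinear k V' W'.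
by split=> [w a v v'|v a w w'] /=; rewrite ?Hf ?Hg; [apply: H1|apply: H2].
Qed.

Lemma tmap_linear (V W V' W' : lmodType k) (f : V -> V') (g : W -> W') :
  linear f -> linear g -> linear (tmap f g).
Proof. by move=> Hf Hg; apply/tlift_linear/tmap_bilinear. Qed.

Lemma tmap_tens (V W V' W' : lmodType k) (f : V -> V') (g : W -> W') v w :
  linear f -> linear g -> tmap f g (tens v w) = tens (f v) (g w).
Proof. by move=> Hf Hg; apply/tlift_tens/tmap_bilinear. Qed.

Lemma tassoc_bilinear0 (U V W : lmodType k) (w : W) :
  bilinear_map (fun (u : U) (v : V) => tens u (tens v w)).
Proof.
have [H1 H2] := @tens_bilinear k U (tensor V W).
have [H3 H4] := @tens_bilinear k V W.
split=> [v a u u'|u a v v'] /=; first exact: H1.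
by have /= -> := H3 w a v v'; apply: H2.
Qed.

Lemma tassoc_bilinear (U V W : lmodType k) :
  bilinear_map (fun (x : tensor U V) (w : W) =>
    tlift (fun u v => tens u (tens v w)) x).
Proof.
split=> [w|x a w w'] /=; first exact/tlift_linear/tassoc_bilinear0.
have [s ->] := tensor_sum x.
pose L w x : tensor U (tensor V W) := tlift (fun u v => tens u (tens v w)) x.
have HL w0 : linear (L w0) by exact/tlift_linear/tassoc_bilinear0.
rewrite -!/(L _ _).
have E w0 : L w0 (\sum_(p <- s) tens p.1 p.2) =
    \sum_(p <- s) tens p.1 (tens p.2 w0).
  elim: s => [|p s IH].
    by rewrite !big_nil linear_at0.
  rewrite !big_cons -{1}[tens _ _]scale1r HL scale1r IH.
  by rewrite {1}/L tlift_tens //; exact: tassoc_bilinear0.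
rewrite !E scaler_sumr -big_split; apply: eq_bigr => p _ /=.
have [H1 H2] := @tens_bilinear k U (tensor V W).
have [H3 H4] := @tens_bilinear k V W.
by have /= -> := H4 p.2 a w w'; apply: H2.
Qed.

Lemma tassoc_linear (U V W : lmodType k) : linear (@tassoc k U V W).
Proof. exact/tlift_linear/tassoc_bilinear. Qed.

Lemma tassoc_tens (U V W : lmodType k) (u : U) (v : V) (w : W) :
  tassoc (tens (tens u v) w) = tens u (tens v w).
Proof.
rewrite /tassoc (tlift_tens _ _ (@tassoc_bilinear U V W)) tlift_tens //.
exact: tassoc_bilinear0.
Qed.

Lemma linear_bigsum (V W : lmodType k) (L : V -> W) (I : Type) (r : seq I)
    (P : pred I) (v : I -> V) : linear L ->
  L (\sum_(i <- r | P i) v i) = \sum_(i <- r | P i) L (v i).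
Proof.
move=> HL; elim: r => [|i r IH].
  by rewrite !big_nil; have := HL (-1) 0 0; rewrite scaler0 addr0 scaleN1r addNr.
by rewrite !big_cons; case: ifP => // _; rewrite -[v i]scale1r HL IH !scale1r.
Qed.

Lemma scalel_bilinear (V : lmodType k) (e : {scalar V}) :
  bilinear_map (fun x y : V => e x *: y).
Proof.
split=> [y a x x'|x a y y'] /=.
  by rewrite linearP scalerDl scalerA.
by rewrite scalerDr !scalerA mulrC.
Qed.

Lemma scaler_bilinear (V : lmodType k) (e : {scalar V}) :
  bilinear_map (fun x y : V => e y *: x).
Proof. by have [H1 H2] := scalel_bilinear e; split=> [y|x] /=; [apply: H2|apply: H1]. Qed.

End TensorLinear.

Section QSymCoalgebra.
Variable k : fieldType.
Implicit Types (a : composition) (f : qsym k).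

Definition qcop : qsym k -> tensor (qsym k) (qsym k) :=
  qlift (fun a => \sum_(i < (size a).+1)
    tens (qM k (comp_take a i)) (qM k (comp_drop a i))).

Definition qeps : qsym k -> k^o := qlift (fun a => (a == comp_nil)%:R : k^o).

Definition qzeta : qsym k -> {poly k} :=
  qlift (fun a => if (size a <= 1)%N then 'X^(sumn a) else 0).

HB.instance Definition _ :=
  GRing.isLinear.Build k (qsym k) (tensor (qsym k) (qsym k)) *:%R qcop
    (qlift_linear _).
Fact qeps_scalar : scalar qeps.
Proof. by move=> x f g; exact: (qlift_linear (fun a => (a == comp_nil)%:R : k^o) x f g). Qed.

HB.instance Definition _ :=
  GRing.isLinear.Build k (qsym k) k *%R qeps qeps_scalar.
HB.instance Definition _ :=
  GRing.isLinear.Build k (qsym k) {poly k} *:%R qzeta (qlift_linear _).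

Lemma qcop_M a : qcop (qM k a) =
  \sum_(i < (size a).+1) tens (qM k (comp_take a i)) (qM k (comp_drop a i)).
Proof. exact: qlift_M. Qed.

Lemma qeps_M a : qeps (qM k a) = (a == comp_nil)%:R.
Proof. exact: qlift_M. Qed.

Lemma qzeta_M a : qzeta (qM k a) = if (size a <= 1)%N then 'X^(sumn a) else 0.
Proof. exact: qlift_M. Qed.

Lemma linear_comp (U V W : lmodType k) (f : V -> W) (g : U -> V) :
  linear f -> linear g -> linear (f \o g).
Proof. by move=> Hf Hg a x y /=; rewrite Hg Hf. Qed.

Let qcop_lin : linear qcop := qlift_linear _.
Let qeps_lin : linear qeps := qlift_linear _.
Let qzeta_lin : linear qzeta := qlift_linear _.
Let id_lin (V : lmodType k) : linear (@id V). Proof. by []. Qed.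

Fact qcopA f : tassoc (tmap qcop id (qcop f)) = tmap id qcop (qcop f).
Proof.
have H1 : linear (tmap qcop (@id (qsym k))) by apply: tmap_linear.
have H2 : linear (tmap (@id (qsym k)) qcop) by apply: tmap_linear.
move: f; apply: qsym_ext => [||a].
- exact: (linear_comp (@tassoc_linear _ _ _ _) (linear_comp H1 qcop_lin)).
- exact: (linear_comp H2 qcop_lin).
have Htens (V W : lmodType k) := @tens_bilinear k V W.
rewrite qcop_M (linear_bigsum _ _ _ H1) (linear_bigsum _ _ _ H2).
rewrite (linear_bigsum _ _ _ (@tassoc_linear _ _ _ _)).
pose M (s : composition) := qM k s; rewrite -/M.
pose T i j := tens (M (comp_take a i))
  (tens (M (comp_take (comp_drop a i) (j - i))) (M (comp_drop a j))).
set n := size a.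
transitivity (\sum_(j < n.+1) \sum_(i < n.+1 | (i <= j)%N) T i j).
  apply: eq_bigr => j _; rewrite tmap_tens // qcop_M.
  rewrite (linear_bigsum _ _ _ ((Htens _ _).1 _)).
  rewrite (linear_bigsum _ _ _ (@tassoc_linear _ _ _ _)).
  under eq_bigr do rewrite tassoc_tens.
  have -> : size (comp_take a j) = j by rewrite size_take_min; apply/minn_idPl; rewrite -ltnS.
  rewrite (big_ord_widen_cond n.+1 xpredT (fun i => tens (M (comp_take (comp_take a j) i))
    (tens (M (comp_drop (comp_take a j) i)) (M (comp_drop a j))))) //=.
  apply: eq_bigr => i; rewrite ltnS => Hij; rewrite /T; congr (tens (M _) (tens (M _) _)).
    by apply: val_inj; rewrite /= take_takel.
  by apply: val_inj; rewrite /= take_drop subnK.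
rewrite (exchange_big_dep xpredT) //=; apply: eq_bigr => i _.
rewrite tmap_tens // qcop_M (linear_bigsum _ _ _ ((Htens _ _).2 _)).
have Hi : (i <= n)%N by rewrite -ltnS.
have -> : size (comp_drop a i) = (n - i)%N by rewrite size_drop.
rewrite -(big_mkord (fun j => (i <= j)%N) (fun j => T i j)).
rewrite -(big_mkord xpredT (fun j => tens (M (comp_take a i))
  (tens (M (comp_take (comp_drop a i) j)) (M (comp_drop (comp_drop a i) j))))).
rewrite (@big_cat_nat _ _ _ i) //=; last exact: leqW.
rewrite big_nat_cond big1 ?add0r; last first.
  by move=> j /andP[/andP[_ Hj] Hij]; move: Hj; rewrite ltnNge Hij.
rewrite -{1}[val i]add0n big_addn subSn // big_mkcond /=; apply: eq_bigr => j _.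
rewrite leq_addl /T addnK; congr (tens _ (tens _ (M _))).
by apply: val_inj; rewrite /= drop_drop.
Qed.

Fact qeps_copl f : tlift (fun x y => qeps x *: y) (qcop f) = f.
Proof.
move: f; have HB := scalel_bilinear qeps; have HL := tlift_linear HB.
apply: qsym_ext => [||a] //; first exact: (linear_comp HL qcop_lin).
rewrite qcop_M (linear_bigsum _ _ _ HL) big_ord_recl tlift_tens //= qeps_M.
rewrite (_ : comp_take a 0 == comp_nil); last by apply/eqP/val_inj; rewrite /= take0.
rewrite big1 => [|i _].
  by rewrite addr0 scale1r; congr qM; apply/val_inj; rewrite /= drop0.
rewrite tlift_tens //= qeps_M; case: eqP => [/(congr1 val) /=|]; last by rewrite scale0r.
by case: a i => -[|x s] Hs [i Hi].
Qed.

Fact qeps_copr f : tlift (fun x y => qeps y *: x) (qcop f) = f.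
Proof.
move: f; have HB := scaler_bilinear qeps; have HL := tlift_linear HB.
apply: qsym_ext => [||a] //; first exact: (linear_comp HL qcop_lin).
rewrite qcop_M (linear_bigsum _ _ _ HL) big_ord_recr tlift_tens //= qeps_M /=.
rewrite (_ : comp_drop a (size a) == comp_nil); last by apply/eqP/val_inj; rewrite /= drop_size.
rewrite big1 => [|i _].
  by rewrite add0r scale1r; congr qM; apply/val_inj; rewrite /= take_size.
rewrite tlift_tens //= qeps_M; case: eqP => [/(congr1 (size \o val)) /=|]; last by rewrite scale0r.
by move/eqP; rewrite size_drop subn_eq0 leqNgt ltn_ord.
Qed.

Lemma sumn_take_drop (s : seq nat) i :
  (sumn (take i s) + sumn (drop i s))%N = sumn s.
Proof. by rewrite -sumn_cat cat_take_drop. Qed.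

Lemma qM_homog a : qsym_homog (sumn a) (qM k a).
Proof.
by apply/qsym_homogP => b; rewrite qcoord_M; case: (b =P a) => [->|_] //; rewrite eqxx.
Qed.

Fact qcop_graded n f : qsym_grading k n f ->
  tensor_homog (qsym_grading k) n (qcop f).
Proof.
move=> [r [Hr ->]].
exists [seq (p.1 *: qM k (comp_take p.2 i), qM k (comp_drop p.2 i)) |
  p <- r, i <- index_iota 0 (size p.2).+1]; split.
  move=> p /allpairsPdep[[x a] [i [Hp _ ->]]] /=.
  exists (sumn (take i a)), (sumn (drop i a)); rewrite sumn_take_drop (Hr _ Hp).
  split=> //; last exact: (qM_homog (comp_drop a i)).
  rewrite -[_ *: _]addr0; apply: qsym_homog_lin; [exact: (qM_homog (comp_take a i))|exact: qsym_homog0].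
rewrite big_allpairs_dep /= (linear_sum _ _ _ qcop_lin); apply: eq_bigr => p _.
rewrite qcop_M scaler_sumr big_mkord; apply: eq_bigr => i _ /=.
have [H _] := @tens_bilinear k (qsym k) (qsym k).
have /= E := H (qM k (comp_drop p.2 i)) p.1 (qM k (comp_take p.2 i)) 0.
have /= E0 := H (qM k (comp_drop p.2 i)) (-1) 0 0.
move: E0 E; rewrite scaler0 addr0 scaleN1r addNr => ->; by rewrite !addr0 => ->.
Qed.

Fact qeps_graded n f : (0 < n)%N -> qsym_grading k n f -> qeps f = 0.
Proof.
move=> Hn [r [Hr ->]]; rewrite (linear_sum _ _ _ qeps_lin) big_seq big1 //.
move=> p /Hr E; rewrite qeps_M; case: (p.2 =P comp_nil) => [H|_]; last by rewrite [LHS]mulr0.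
by move: Hn; rewrite -E H.
Qed.

Definition qsym_gradedCoalgebra : gradedCoalgebra (qsym k) :=
  GradedCoalgebra qcopA qeps_copl qeps_copr qcop_graded qeps_graded.

Fact qzeta_graded n f : gr qsym_gradedCoalgebra n f -> poly_homog n (qzeta f).
Proof.
move=> [r [Hr ->]]; rewrite (linear_sum _ _ _ qzeta_lin).
exists (\sum_(p <- r) (p.1 *+ (size p.2 <= 1)%N)).
rewrite scaler_suml big_seq [RHS]big_seq; apply: eq_bigr => p /Hr E.
by rewrite qzeta_M E; case: ifP => _; rewrite ?mulr1n // mulr0n scale0r scaler0.
Qed.

Fact qzeta_at0 f : (qzeta f).[0] = eps qsym_gradedCoalgebra f.
Proof.
have Hz : linear (fun f => (qzeta f).[0] : k^o).
  by move=> x g h; rewrite linearP hornerD hornerZ.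
apply: (qsym_ext Hz qeps_lin) => a; rewrite qzeta_M qeps_M.
case: ifP => Ha; last by rewrite horner0; case: eqP => // E; rewrite E in Ha.
rewrite hornerXn; case: a Ha => -[|x [|]] //= Hs _; rewrite ?expr0 //.
by rewrite addn0 expr0n; case: x Hs.
Qed.

Definition qsym_combCoalgebra : combCoalgebra (qsym k) :=
  CombCoalgebra qzeta_graded qzeta_at0.

End QSymCoalgebra.

Section TensorPowerCoef.
Variable k : fieldType.
Implicit Types (a b : nat -> nat) (n : nat).

Lemma tpow_coef_bilinear a n i : linear (@tpow_coef k a n) ->
  bilinear_map (fun (x : tpow {poly k} n) (p : {poly k}) =>
    tpow_coef a x * p`_i : k^o).
Proof.
move=> H; split=> [p x u v|u x p q] /=.
  by rewrite H mulrDl -scalerAl.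
by rewrite coefD coefZ mulrDr mulrCA.
Qed.

Lemma tpow_coef_linear a n : linear (@tpow_coef k a n).
Proof.
elim: n => [|n IH]; first by move=> x p q; rewrite /= coefD coefZ.
exact/tlift_linear/tpow_coef_bilinear.
Qed.

Fixpoint tpow_pure (V : lmodType k) (f : nat -> V) n : tpow V n :=
  if n is n'.+1 then tens (tpow_pure f n') (f n) else f 0%N.

Lemma tpow_coef_pure a b n :
  tpow_coef a (tpow_pure (fun i => 'X^(b i) : {poly k}) n) =
  \prod_(i < n.+1) (a i == b i)%:R.
Proof.
elim: n => [|n IH]; first by rewrite big_ord1 /= coefXn.
rewrite big_ord_recr -IH /= tlift_tens ?coefXn //.
exact/tpow_coef_bilinear/tpow_coef_linear.
Qed.

End TensorPowerCoef.

Section Psi.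
Variables (k : fieldType) (V : lmodType k) (C : combCoalgebra V).

Definition zeta_comp (a : composition) (v : V) : k :=
  if parts a is [::] then eps C v
  else tpow_coef (nth 0%N a) (tpow_map (zeta C) (iter_cop C (size a).-1 v)).

(* A sum over a set is over the indices of nonzero terms, and is 0 by
   convention if there are infinitely many of these. *)
Definition psi (v : V) : qsym k :=
  \sum_(a \in [set: composition]) zeta_comp a v *: qM k a.

End Psi.

(* Main.v *)
Require Import Defs.
From mathcomp Require Import all_boot all_order all_algebra.
From mathcomp Require Import finmap classical_sets fsbigop.
From mathcomp.multinomials Require Import monalg.

Set Implicit Arguments.
Unset Strict Implicit.
Unset Printing Implicit Defensive.

Import GRing.Theory.
Local Open Scope ring_scope.

(** The dual of a coalgebra [V] is an algebra under convolution,
    [conv f g = (f (x) g) o Delta], with unit [eps].  Let [zcoef n v] be the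
    coefficient of [t^n] in [zeta v], and let [zeta_seq s] be the convolution
    product of the [zcoef n] for [n] in [s].  Coassociativity lets the iterated
    coproduct be bracketed freely, so the functional zeta_alpha of the
    definition of [psi] is [zeta_seq alpha] ([zeta_compE]).  The grading makes
    [zeta_seq s v] vanish when [sumn s] is large, so that the coordinates of
    [psi v] in the basis M are exactly the [zeta_seq alpha v] ([qcoord_psi]).

    On QSym the coproduct by deconcatenation is dual to concatenation:
    the coordinate functionals satisfy
    [conv (qcoord a) (qcoord b) = qcoord (a b)] ([qcoord_qcop]), just as
    [zeta_seq] turns concatenation into convolution ([zeta_seq_cat]).  Since
    these pairs of coordinates separate the points of QSym (x) QSym
    ([qsym_tensorP]), [psi] commutes with the coproducts.  For uniqueness,
    [zcoef n] is [qcoord (n)] on QSym when [0 < n], so [zeta_seq a] is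
    [qcoord a] there ([zeta_seq_qsym]); a morphism [phi] pulls convolutions
    back to convolutions, so
    [qcoord a (phi v) = zeta_seq a (phi v) = zeta_seq a v].

    For a bialgebra, multiplicativity of [Delta] and [zeta] gives
    [zeta_seq s (a b)] as the sum of [zeta_seq s' a * zeta_seq s'' b] over the
    ways to write [s] as a termwise sum [s' + s''], zero entries being allowed
    ([zeta_seq_mul]).  As [zcoef 0] is the unit [eps], zero entries may be
    inserted or erased, so the coefficient of a monomial [m] in [psi v] is the
    value at [v] of [zeta_seq s], where [s] lists the exponents of [m] along
    any increasing list of variables that contains its support
    ([qseries_psi]).  Along the support of [m], the splittings of the exponents
    of [m] are the factorizations of [m] ([perm_factors_splits]), so the
    formula for [zeta_seq s (a b)] is the product rule of power series. *)

(** * Functionals on tensor products *)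

Section TensorFunctionals.
Variable k : fieldType.

Lemma linear_scale (V W : lmodType k) (L : V -> W) a v :
  linear L -> L (a *: v) = a *: L v.
Proof. by move=> HL; rewrite -[a *: v]addr0 HL (linear_at0 HL) addr0. Qed.

Lemma eq_tlift (V W X : lmodType k) (b b' : V -> W -> X) :
  (forall v w, b v w = b' v w) -> tlift b =1 tlift b'.
Proof. by move=> H x; apply: eq_bigr => p _; apply: H. Qed.

Lemma linear_tlift (V W X Y : lmodType k) (L : X -> Y) (b : V -> W -> X) x :
  linear L -> L (tlift b x) = tlift (fun v w => L (b v w)) x.
Proof. exact: linear_bigsum. Qed.

Lemma tlift_tmap (V W V' W' X : lmodType k) (b : V' -> W' -> X)
    (f : V -> V') (g : W -> W') x : bilinear_map b ->
  tlift b (tmap f g x) = tlift (fun v w => b (f v) (g w)) x.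
Proof.
move=> Hb; rewrite (linear_tlift _ _ (tlift_linear Hb)).
by apply: eq_tlift => v w; rewrite tlift_tens.
Qed.

Definition fprod (V W : lmodType k) (f : V -> k^o) (g : W -> k^o) :
    tensor V W -> k^o :=
  tlift (fun v w => f v * g w).

Lemma fprod_bilinear (V W : lmodType k) (f : V -> k^o) (g : W -> k^o) :
  linear f -> linear g -> bilinear_map (fun v w => f v * g w : k^o).
Proof.
move=> Hf Hg; split=> [w a v v'|v a w w'] /=.
  by rewrite Hf mulrDl -scalerAl.
by rewrite Hg mulrDr scalerAr.
Qed.

Lemma fprod_linear (V W : lmodType k) (f : V -> k^o) (g : W -> k^o) :
  linear f -> linear g -> linear (fprod f g).
Proof. by move=> Hf Hg; apply/tlift_linear/fprod_bilinear. Qed.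

Lemma fprod_tens (V W : lmodType k) (f : V -> k^o) (g : W -> k^o) v w :
  linear f -> linear g -> fprod f g (tens v w) = f v * g w.
Proof. by move=> Hf Hg; apply/tlift_tens/fprod_bilinear. Qed.

Lemma eq_fprod (V W : lmodType k) (f f' : V -> k^o) (g g' : W -> k^o) :
  f =1 f' -> g =1 g' -> fprod f g =1 fprod f' g'.
Proof. by move=> Hf Hg; apply: eq_tlift => v w; rewrite Hf Hg. Qed.

Lemma fprod_tmap (V W V' W' : lmodType k) (f : V' -> k^o) (g : W' -> k^o)
    (p : V -> V') (q : W -> W') x : linear f -> linear g ->
  fprod f g (tmap p q x) = fprod (fun v => f (p v)) (fun w => g (q w)) x.
Proof. by move=> Hf Hg; apply/tlift_tmap/fprod_bilinear. Qed.

Lemma fprod_tassoc (U V W : lmodType k) (f : U -> k^o) (g : V -> k^o)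
    (h : W -> k^o) x : linear f -> linear g -> linear h ->
  fprod f (fprod g h) (tassoc x) = fprod (fprod f g) h x.
Proof.
move=> Hf Hg Hh; have Hfg := fprod_linear Hf Hg; have Hgh := fprod_linear Hg Hh.
have HL := linear_comp (fprod_linear Hf Hgh) (@tassoc_linear k U V W).
move: x; apply: (tensor_ext HL) => [|y w]; first exact: fprod_linear.
have Hw := (@tens_bilinear k (tensor U V) W).1 w.
move: y; apply: tensor_ext => [|| u v].
- exact: (linear_comp HL Hw).
- exact: (linear_comp (fprod_linear Hfg Hh) Hw).
by rewrite /= tassoc_tens !fprod_tens // mulrA.
Qed.

(** Both sides expand into sums over representatives of [x] and [y], where they
    differ only by the order of summation. *)
Lemma fprod_tmul (A : algType k) (I J : Type) (r : seq I) (s : seq J)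
    (f g : A -> k^o) (f1 f2 : I -> A -> k^o) (g1 g2 : J -> A -> k^o) x y :
  linear f -> linear g ->
  (forall a b, f (a * b) = \sum_(i <- r) f1 i a * f2 i b) ->
  (forall a b, g (a * b) = \sum_(j <- s) g1 j a * g2 j b) ->
  fprod f g (tmul x y) =
  \sum_(i <- r) \sum_(j <- s)
    (fprod (f1 i) (g1 j) x : k) * fprod (f2 i) (g2 j) y.
Proof.
move=> Hf Hg Ef Eg; have HL := fprod_linear Hf Hg.
rewrite (linear_tlift _ _ HL).
under eq_tlift => a b.
  rewrite (linear_tlift _ _ HL).
  under eq_tlift => c d do rewrite fprod_tens // Ef Eg.
  over.
rewrite /fprod /tlift /formal_eval.
under [RHS]eq_bigr => i _.
  under eq_bigr => j _.
    rewrite mulr_suml; under eq_bigr => p _ do rewrite mulr_sumr.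
    over.
  rewrite exchange_big; under eq_bigr => p _ do rewrite exchange_big.
  over.
rewrite [RHS]exchange_big; apply: eq_bigr => p _.
rewrite [RHS]exchange_big; apply: eq_bigr => q _ /=.
rewrite mulr_suml; apply: eq_bigr => i _.
by rewrite mulr_sumr; apply: eq_bigr => j _; rewrite mulrACA.
Qed.

End TensorFunctionals.

(** * Convolution on the dual of a graded coalgebra *)

Section Convolution.
Variables (k : fieldType) (V : lmodType k) (C : gradedCoalgebra V).
Implicit Types f g h : V -> k^o.

Definition conv f g v : k^o := fprod f g (cop C v).

Lemma cop_linear : linear (cop C).
Proof. exact: linearP. Qed.

Lemma eps_linear : linear (eps C : V -> k^o).
Proof. exact: linearP. Qed.

Lemma conv_linear f g : linear f -> linear g -> linear (conv f g).
Proof.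
by move=> Hf Hg; exact: (linear_comp (fprod_linear Hf Hg) cop_linear).
Qed.

Lemma eq_conv f f' g g' : f =1 f' -> g =1 g' -> conv f g =1 conv f' g'.
Proof. by move=> Hf Hg v; apply: eq_fprod. Qed.

Lemma convA f g h : linear f -> linear g -> linear h ->
  conv f (conv g h) =1 conv (conv f g) h.
Proof.
move=> Hf Hg Hh v; have Hfg := fprod_linear Hf Hg; have Hgh := fprod_linear Hg Hh.
transitivity (fprod f (fprod g h) (tmap id (cop C) (cop C v))).
  by rewrite fprod_tmap.
by rewrite -copA fprod_tassoc // fprod_tmap.
Qed.

Lemma conv_epsl f : linear f -> conv (eps C) f =1 f.
Proof.
move=> Hf v; rewrite -[in RHS](eps_copl C v) (linear_tlift _ _ Hf).
by apply: eq_tlift => x y; rewrite linear_scale.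
Qed.

Lemma conv_epsr f : linear f -> conv f (eps C) =1 f.
Proof.
move=> Hf v; rewrite -[in RHS](eps_copr C v) (linear_tlift _ _ Hf).
by apply: eq_tlift => x y; rewrite linear_scale // [LHS]mulrC.
Qed.

(** The two middle hypotheses say that [f] and [g] are homogeneous of degrees
    [i] and [j]; then a component of bidegree [(a, b)] of the coproduct of [v]
    contributes only if [(a, b) = (i, j)]. *)
Lemma conv_graded f g i j : linear f -> linear g ->
  (forall n v, gr C n v -> f v != 0 -> n = i) ->
  (forall n v, gr C n v -> g v != 0 -> n = j) ->
  forall n v, gr C n v -> conv f g v != 0 -> n = (i + j)%N.
Proof.
move=> Hf Hg Gf Gg n v /cop_graded [s [Hs E]].
rewrite /conv E (linear_bigsum _ _ _ (fprod_linear Hf Hg)) => Hne.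
case: (n =P (i + j)%N) => // Hn; case/eqP: Hne; rewrite big_seq big1 // => p.
move=> /Hs[a [b [Hab Ha Hb]]]; rewrite fprod_tens //.
case: (eqVneq (f p.1) 0) => [->|/(Gf _ _ Ha) Ea]; first by rewrite mul0r.
case: (eqVneq (g p.2) 0) => [->|/(Gg _ _ Hb) Eb]; first by rewrite mulr0.
by case: Hn; rewrite -Hab Ea Eb.
Qed.

End Convolution.

Lemma conv_morphism (k : fieldType) (V V' : lmodType k)
    (C : gradedCoalgebra V) (C' : gradedCoalgebra V') (phi : V -> V')
    (f g : V' -> k^o) v :
  coalgebra_morphism C C' phi -> linear f -> linear g ->
  conv C' f g (phi v) = conv C (fun x => f (phi x)) (fun x => g (phi x)) v.
Proof. by move=> [_ _ Hc _] Hf Hg; rewrite /conv Hc fprod_tmap. Qed.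

(** * Convolution products of the coefficients of zeta *)

Section ZetaSeq.
Variables (k : fieldType) (V : lmodType k) (C : combCoalgebra V).

Definition zcoef n (v : V) : k^o := (zeta C v)`_n.

(** The list may have zero entries, unlike a composition: they occur when the
    parts of a composition are split in all possible ways as sums. *)
Definition zeta_seq (s : seq nat) : V -> k^o :=
  foldr (fun n => conv C (zcoef n)) (eps C) s.

Lemma zcoef_linear n : linear (zcoef n).
Proof. by move=> a u v; rewrite /zcoef linearP coefD coefZ. Qed.

Lemma zcoef0 : zcoef 0 =1 eps C.
Proof. by move=> v; rewrite -zeta_at0 horner_coef0. Qed.

Lemma zeta_seq_linear s : linear (zeta_seq s).
Proof.
elim: s => [|n s IH]; first exact: eps_linear.
by apply: conv_linear => //; exact: zcoef_linear.
Qed.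

Lemma zeta_seq1 n : zeta_seq [:: n] =1 zcoef n.
Proof. exact/conv_epsr/zcoef_linear. Qed.

Lemma zeta_seq_cat s t : zeta_seq (s ++ t) =1 conv C (zeta_seq s) (zeta_seq t).
Proof.
move=> v; elim: s v => [|n s IH] v /=.
  by rewrite conv_epsl //; exact: zeta_seq_linear.
rewrite -convA; [exact: eq_conv|exact: zcoef_linear|exact: zeta_seq_linear..].
Qed.

(** Zero entries contribute the factor [zcoef 0 = eps], the unit of [conv]. *)
Lemma zeta_seq_nonzero s : zeta_seq [seq n <- s | n != 0%N] =1 zeta_seq s.
Proof.
elim: s => [|[|n] s IH] v //=; last exact: eq_conv.
by rewrite IH (eq_conv _ zcoef0 (frefl _)) conv_epsl //; exact: zeta_seq_linear.
Qed.

Lemma zeta_seq_graded s n v : gr C n v -> zeta_seq s v != 0 -> n = sumn s.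
Proof.
elim: s n v => [|m s IH] n v.
  case: n => [//|n] Hv; rewrite /zeta_seq /= (eps_graded _ Hv) //.
  by rewrite eqxx.
apply: conv_graded => //; [exact: zcoef_linear|exact: zeta_seq_linear|].
move=> i u /zeta_graded[c E]; rewrite /zcoef E coefZ coefXn.
by case: (m =P i) => [->|_] /=; rewrite ?mulr0 ?eqxx.
Qed.

(** Only finitely many homogeneous components of [v] are nonzero; this is what
    makes the sum that defines [psi v] finite. *)
Lemma zeta_seq_bounded v : exists N, forall s, zeta_seq s v != 0 -> (sumn s <= N)%N.
Proof.
have [N [f [Hf ->]]] := homog_sum (gr C) v; exists N => s.
rewrite (linear_bigsum _ _ _ (zeta_seq_linear s)) leqNgt; apply: contra => Hs.
apply/eqP/big1 => i _; apply/eqP; apply: contraT => /(zeta_seq_graded (Hf i)) E.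
by move: Hs; rewrite -E ltnNge ltnW.
Qed.

Lemma iter_cop_linear n : linear (iter_cop C n).
Proof.
elim: n => [|n IH] //=.
have H : linear (tmap (iter_cop C n) (@id V)) by apply: tmap_linear.
exact: (linear_comp H (cop_linear C)).
Qed.

Lemma tpow_map_linear (W : lmodType k) (f : V -> W) n :
  linear f -> linear (@tpow_map _ _ _ f n).
Proof. by move=> Hf; elim: n => [|n IH] //=; apply: tmap_linear. Qed.

(** The tensor powers are nested to the left, so the last factor splits off
    first and the list of exponents grows at its end; [zeta_seq_cat] rebrackets
    the resulting convolution. *)
Lemma tpow_coef_iter_cop c n v :
  tpow_coef c (tpow_map (zeta C) (iter_cop C n v)) = zeta_seq (mkseq c n.+1) v.
Proof.
elim: n v => [|n IH] v; first by rewrite zeta_seq1.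
rewrite mkseqS -cats1 zeta_seq_cat [LHS]/=.
have Hb := tpow_coef_bilinear (c n.+1) (@tpow_coef_linear k c n).
have Hz : linear (zeta C) by exact: linearP.
have Ht := @tpow_map_linear _ _ n Hz.
rewrite tlift_tmap // tlift_tmap; last first.
  split=> [w a x x'|x a w w'] /=; first by rewrite Ht; apply: Hb.1.
  by rewrite Hz; apply: Hb.2.
by apply: eq_tlift => x y; rewrite IH zeta_seq1.
Qed.

Lemma zeta_compE (a : composition) v : zeta_comp C a v = zeta_seq a v.
Proof.
case: a => -[|n s] Hs; first by [].
by rewrite [LHS]tpow_coef_iter_cop [mkseq _ _](mkseq_nth 0%N (n :: s)).
Qed.

Lemma qcoord_psi a v : qcoord a (psi C v) = zeta_seq a v.
Proof.
have [N HN] := zeta_seq_bounded v.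
(* The compositions outside [comps N] have vanishing coefficients. *)
have -> : psi C v = \sum_(b <- comps N) zeta_comp C b v *: qM k b.
  rewrite /psi -(@fsbig_widen _ _ 0 +%R [set` comps N]).
  - by rewrite -fsbig_seq // comps_uniq.
  - by [].
  - move=> b /= [_ Hb]; apply/eqP; rewrite scaler_eq0; apply/orP; left.
    by apply: contraT; rewrite zeta_compE => /HN /mem_comps.
rewrite (Defs.linear_sum _ _ _ (@qcoord_linear k a)).
have Hne b : b != a -> zeta_comp C b v *: (qcoord a (qM k b) : k^o) = 0.
  by rewrite qcoord_M eq_sym => /negbTE ->; rewrite scaler0.
case: (eqVneq (zeta_seq a v) 0) => [Ha|/HN/mem_comps Hin].
  rewrite big1 // => b _; case: (eqVneq b a) => [->|/Hne //].
  by rewrite zeta_compE Ha scale0r.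
rewrite (bigD1_seq a) ?comps_uniq // big1 // qcoord_M eqxx zeta_compE.
exact: etrans (addr0 _) (mulr1 _).
Qed.

End ZetaSeq.

(** * Coordinates on QSym (x) QSym *)

Section QSymTensor.
Variable k : fieldType.
Implicit Types a b c : composition.

(** A bound valid for all larger [N] lets two tensors be expanded over the same
    finite set of compositions. *)
Lemma qsym_tensor_expand (x : tensor (qsym k) (qsym k)) :
  exists N0, forall N, (N0 <= N)%N ->
    x = \sum_(a <- comps N) \sum_(b <- comps N)
      (fprod (@qcoord k a) (@qcoord k b) x : k) *: tens (qM k a) (qM k b).
Proof.
have [s ->] := tensor_sum x; elim: s => [|[f g] s [N0 IH]].
  exists 0%N => N _; rewrite big_nil big1 // => a _; rewrite big1 // => b _.
  by rewrite linear_at0 ?scale0r //; exact: fprod_linear.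
have [Nf Hf] := qcoord_bounded f; have [Ng Hg] := qcoord_bounded g.
exists (N0 + Nf + Ng)%N => N HN; rewrite big_cons {1}(IH N); last first.
  by rewrite (leq_trans _ HN) // -addnA leq_addr.
have Ef : f = \sum_(a <- comps N) qcoord a f *: qM k a.
  rewrite -{1}[f]qlift_qM; apply: qliftE => a /Hf/leq_trans; apply.
  by rewrite (leq_trans _ HN) // addnAC leq_addl.
have Eg : g = \sum_(a <- comps N) qcoord a g *: qM k a.
  rewrite -{1}[g]qlift_qM; apply: qliftE => a /Hg/leq_trans; apply.
  by rewrite (leq_trans _ HN) // leq_addl.
have [Hl Hr] := @tens_bilinear k (qsym k) (qsym k).
rewrite /= {1}Ef (Defs.linear_sum _ _ _ (Hl g)) -big_split; apply: eq_bigr => a _ /=.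
rewrite {1}Eg (Defs.linear_sum _ _ _ (Hr _)) scaler_sumr -big_split.
apply: eq_bigr => b _ /=; have HL := fprod_linear (@qcoord_linear k a) (@qcoord_linear k b).
have := HL 1 (tens f g) (\sum_(p <- s) tens p.1 p.2).
by rewrite !scale1r => ->; rewrite scalerDl scalerA fprod_tens.
Qed.

Lemma qsym_tensorP (x y : tensor (qsym k) (qsym k)) :
  (forall a b, fprod (@qcoord k a) (@qcoord k b) x =
    fprod (@qcoord k a) (@qcoord k b) y) -> x = y.
Proof.
move=> H; have [N Hx] := qsym_tensor_expand x; have [N' Hy] := qsym_tensor_expand y.
rewrite (Hx (N + N')%N) ?leq_addr // (Hy (N + N')%N) ?leq_addl //.
by apply: eq_bigr => a _; apply: eq_bigr => b _; rewrite H.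
Qed.

Lemma comp_cat_subproof a b : 0%N \notin parts a ++ parts b.
Proof. by rewrite mem_cat negb_or !parts_gt0. Qed.
Definition comp_cat a b := Composition (comp_cat_subproof a b).

(** In the coproduct of M_c, the term M_a (x) M_b occurs exactly when [c] is
    the concatenation of [a] and [b], and then only at the cut after [size a]
    parts. *)
Lemma qcoord_qcop a b f :
  fprod (@qcoord k a) (@qcoord k b) (qcop f) = qcoord (comp_cat a b) f.
Proof.
have HL := fprod_linear (@qcoord_linear k a) (@qcoord_linear k b).
move: f; apply: qsym_ext => [||c].
- exact: (linear_comp HL (qlift_linear _)).
- exact: qcoord_linear.
rewrite qcop_M (linear_bigsum _ _ _ HL) qcoord_M.
under eq_bigr do rewrite fprod_tens // !qcoord_M -natrM mulnb.
case: eqP => [<-|Hc]; last first.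
  rewrite big1 // => i _; case: andP => // -[/eqP Ea /eqP Eb]; case: Hc.
  by apply: val_inj; rewrite /= Ea Eb /= cat_take_drop.
have Et : comp_take (comp_cat a b) (size a) = a.
  by apply: val_inj; apply: take_size_cat.
have Ed : comp_drop (comp_cat a b) (size a) = b.
  by apply: val_inj; apply: drop_size_cat.
have Ha : (size a < (size (comp_cat a b)).+1)%N by rewrite ltnS size_cat leq_addr.
rewrite (bigD1 (Ordinal Ha)) //= Et Ed !eqxx big1 ?addr0 // => i Hi.
case: andP => // -[/eqP/(congr1 (size \o val)) /= Ei _]; case/eqP: Hi.
by apply: val_inj; rewrite /= Ei size_takel // -ltnS.
Qed.

Lemma zcoef_qsym n f (Hn : 0%N \notin [:: n]) :
  zcoef (qsym_combCoalgebra k) n f = qcoord (Composition Hn) f.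
Proof.
move: f; apply: qsym_ext => [||c]; first exact: zcoef_linear.
  exact: qcoord_linear.
rewrite qcoord_M /zcoef [zeta _ _](qzeta_M k c); case: ifP => Hc; last first.
  by rewrite coef0; case: eqP Hc => // <-.
rewrite coefXn; congr (nat_of_bool _)%:R; apply/eqP/eqP => [En|<-]; last first.
  by rewrite /= addn0.
apply: val_inj => /=; case: c En Hc => -[|m [|]] //= _ En _.
  by rewrite En in Hn.
by rewrite En addn0.
Qed.

(** By [qcoord_qcop], convolving with [zcoef n] on the left prepends the part
    [n] to the composition whose coordinate is taken. *)
Lemma zeta_seq_qsym a f : zeta_seq (qsym_combCoalgebra k) a f = qcoord a f.
Proof.
case: a => s Hs; elim: s Hs f => [|n s IH] Hs f.
  move: f; apply: qsym_ext => [||c]; first exact: zeta_seq_linear.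
    exact: qcoord_linear.
  by rewrite qcoord_M [LHS]qeps_M eq_sym; congr (nat_of_bool (_ == _))%:R; apply: val_inj.
have Hn : 0%N \notin [:: n] by apply: contra Hs; rewrite !inE => ->.
have Hs' : 0%N \notin s by apply: contra Hs; rewrite inE orbC => ->.
rewrite /= (eq_conv _ (fun g => zcoef_qsym g Hn) (IH Hs')) [LHS]qcoord_qcop.
by congr (qcoord _ f); apply: val_inj.
Qed.

End QSymTensor.

(** * Existence and uniqueness of the morphism to QSym *)

Section PsiMorphism.
Variables (k : fieldType) (V : lmodType k) (C : combCoalgebra V).

Lemma psi_linear : linear (psi C).
Proof.
move=> x u v; apply: qcoordP => a.
by rewrite qcoord_linear !qcoord_psi zeta_seq_linear.
Qed.

Lemma psi_coalgebra_morphism :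
  coalgebra_morphism C (qsym_combCoalgebra k) (psi C).
Proof.
split=> [|n v Hv|v|v]; first exact: psi_linear.
- apply/qsym_homogP => a; rewrite qcoord_psi => Ha.
  exact/esym/(zeta_seq_graded Hv Ha).
- apply: qsym_tensorP => a b; rewrite [LHS]qcoord_qcop qcoord_psi /=.
  rewrite zeta_seq_cat fprod_tmap //.
  by apply: eq_fprod => u; rewrite qcoord_psi.
by rewrite -[LHS]/(zeta_seq (qsym_combCoalgebra k) comp_nil _)
  zeta_seq_qsym qcoord_psi.
Qed.

Lemma psi_combCoalgebra_morphism :
  combCoalgebra_morphism C (qsym_combCoalgebra k) (psi C).
Proof.
split=> [|v]; first exact: psi_coalgebra_morphism.
apply/polyP => -[|n].
  have := zcoef0 C v; rewrite /zcoef => ->.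
  have := zcoef0 (qsym_combCoalgebra k) (psi C v); rewrite /zcoef => ->.
  by rewrite (mor_eps psi_coalgebra_morphism).
rewrite -[RHS]/(zcoef (qsym_combCoalgebra k) n.+1 _) zcoef_qsym qcoord_psi.
by rewrite zeta_seq1.
Qed.

(** The functionals [zeta_seq s] are natural, being built from the coproduct,
    the counit and zeta, all of which [phi] preserves. *)
Lemma zeta_seq_morphism (W : lmodType k) (D : combCoalgebra W) (phi : V -> W) s v :
  combCoalgebra_morphism C D phi -> zeta_seq C s v = zeta_seq D s (phi v).
Proof.
move=> [Hphi Hz]; elim: s v => [|n s IH] v; first by rewrite /= (mor_eps Hphi).
rewrite /= (conv_morphism _ Hphi); [|exact: zcoef_linear|exact: zeta_seq_linear].
by apply: eq_conv => [u|u]; rewrite ?IH // /zcoef Hz.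
Qed.

Lemma combCoalgebra_morphism_unique (phi : V -> qsym k) :
  combCoalgebra_morphism C (qsym_combCoalgebra k) phi -> phi =1 psi C.
Proof.
move=> Hphi v; apply: qcoordP => a.
by rewrite qcoord_psi (zeta_seq_morphism _ _ Hphi) zeta_seq_qsym.
Qed.

(** Allowing variables outside the support of [m] gives the two factors of a
    monomial a common list of variables. *)
Lemma qseries_psi v (s : seq nat) (m : mono) : sorted ltn s ->
  {subset finsupp m <= s} -> qseries (psi C v) m = zeta_seq C (exps s m) v.
Proof.
by move=> Hs Hm; rewrite qcoord_flat qcoord_psi (flat_sub Hs Hm) zeta_seq_nonzero.
Qed.

End PsiMorphism.

(** * Factorizations of a monomial and splittings of its exponents *)

Section Splits.
Implicit Types (s e : seq nat) (m : mono).

Fixpoint splits e : seq (seq nat * seq nat) :=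
  if e is n :: e' then
    [seq (i :: p.1, (n - i)%N :: p.2) | i <- index_iota 0 n.+1, p <- splits e']
  else [:: ([::], [::])].

Lemma mem_splits e (p : seq nat * seq nat) :
  (p \in splits e) = [&& size p.1 == size e, size p.2 == size e &
    [seq (x.1 + x.2)%N | x <- zip p.1 p.2] == e].
Proof.
case: p => u v; elim: e u v => [|n e IH] u v.
  by rewrite inE; case: u v => [|? ?] [|? ?].
apply/allpairsPdep/idP => [[i [[u' v'] [Hi Hp [-> ->]]]]|].
  move: Hp Hi; rewrite IH mem_index_iota ltnS => /and3P[/eqP Eu /eqP Ev /eqP E] Hi.
  by rewrite /= Eu Ev E subnKC // !eqxx.
case: u v => [|i u] [|j v]; rewrite /= ?eqSS ?andbF // => /and3P[Hu Hv /eqP[E Huv]].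
exists i, (u, v); rewrite /= mem_index_iota ltnS -E leq_addr addKn IH.
by split=> //; apply/and3P; split=> //; apply/eqP.
Qed.

Lemma splits_uniq e : uniq (splits e).
Proof.
elim: e => [//|n e IH]; apply: uniq_allpairs_dep => //; first exact: iota_uniq.
by move=> i [u v] j [u' v'] _ _ _ _ /= [-> -> _ ->].
Qed.

Lemma perm_factors_splits m :
  perm_eq [seq (exps (msorted m) p.1, exps (msorted m) p.2) | p <- factors m]
    (splits (exps (msorted m) m)).
Proof.
set s := msorted m; have Us : uniq s := msorted_uniq m.
have sK (q : mono) : {subset finsupp q <= s} -> monomial s (exps s q) = q.
  exact: monomial_exps.
apply: uniq_perm; last 1 first.
- move=> [u v]; rewrite mem_splits /= size_map.
  apply/mapP/and3P => [[[p q]]|[/eqP Hu /eqP Hv /eqP E]].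
    by rewrite mem_factors /= => /eqP <- [-> ->]; rewrite !size_map expsM.
  exists (monomial s u, monomial s v); last by rewrite /= !exps_monomial.
  rewrite mem_factors /= -monomialD ?Hu ?Hv // E sK // => i.
  by rewrite mem_msorted.
- rewrite map_inj_in_uniq ?fset_uniq // => -[p q] [p' q'].
  move=> /factor_sub[/= Hp Hq] /factor_sub[/= Hp' Hq'] [Ep Eq].
  by rewrite -(sK p) // -(sK q) // Ep Eq !sK.
exact: splits_uniq.
Qed.

End Splits.

(** * Multiplicativity for combinatorial bialgebras *)

Section Bialgebra.
Variables (k : fieldType) (A : algType k) (C : combCoalgebra A).
Hypothesis HC : is_combBialgebra C.

Let HG : is_gradedBialgebra C := comb_gradedBialgebra HC.

Lemma zeta_seq_mul s a b : zeta_seq C s (a * b) =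
  \sum_(p <- splits s) zeta_seq C p.1 a * zeta_seq C p.2 b.
Proof.
elim: s a b => [|n s IH] a b; first by rewrite big_seq1 [LHS](eps_mul HG).
rewrite big_allpairs_dep /= /conv (cop_mul HG).
apply: (@fprod_tmul k A _ _ _ _ _ _ (zcoef C) (fun i => zcoef C (n - i))
  (fun p => zeta_seq C p.1) (fun p => zeta_seq C p.2)) => [||c d|//].
- exact: zcoef_linear.
- exact: zeta_seq_linear.
by rewrite /zcoef (zeta_mul HC) coefM big_mkord.
Qed.

Lemma zeta_seq_one s : zeta_seq C s 1 = (sumn s == 0%N)%:R.
Proof.
elim: s => [|n s IH]; first exact: (eps_one HG).
rewrite /= /conv (cop_one HG) fprod_tens; [|exact: zcoef_linear|exact: zeta_seq_linear].
by rewrite IH /zcoef (zeta_one HC) coef1 -natrM mulnb addn_eq0.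
Qed.

Lemma psi_one : psi C 1 = 1.
Proof.
apply: qcoordP => a; rewrite qcoord_psi zeta_seq_one.
rewrite [RHS](_ : _ = (rep a == mone)%:R) //.
by rewrite -mdeg_eq0 -sumn_flat flat_rep.
Qed.

Lemma psi_mul a b : psi C (a * b) = psi C a * psi C b.
Proof.
apply/val_inj/seriesP => m /=.
have Hs := cmono_sorted m.
rewrite (qseries_psi C _ Hs) // => [|i]; last by rewrite mem_msorted.
rewrite zeta_seq_mul -(perm_big _ (perm_factors_splits m)) big_map.
rewrite [RHS](series_mulE (psi C a) (psi C b)) big_seq [RHS]big_seq.
apply: eq_bigr => p /factor_sub[Hp Hq] /=.
by rewrite -!qseries_psi.
Qed.

End Bialgebra.

(** * The universal property of QSym *)

Theorem theorem7p4 (k : fieldType) :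
  (forall (V : lmodType k) (C : combCoalgebra V),
     combCoalgebra_morphism C (qsym_combCoalgebra k) (psi C) /\
     (forall phi : V -> qsym k,
        combCoalgebra_morphism C (qsym_combCoalgebra k) phi ->
        phi =1 psi C)) /\
  (forall (A : algType k) (C : combCoalgebra A),
     is_combBialgebra C ->
     bialgebra_morphism C (qsym_combCoalgebra k) (psi C)).
Proof.
split=> [V C|A C HC].
  by split; [exact: psi_combCoalgebra_morphism|exact: combCoalgebra_morphism_unique].
split; [exact: psi_coalgebra_morphism|exact: psi_one|exact: psi_mul].
Qed.
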